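(* Let $\alpha\in[0,1]$, $\rho>0$, and let $a_0(n),a_1(n)$ be convergent real sequences with limits $l_i=\lim_{n\to\infty}a_i(n)$, $i=0,1$, such that for every $n$ $$2a_0(n)+a_1(n)=1\qquad\text{and}\qquad \bigl(a_0(n)<0\ \text{ or }\ a_0(n)+a_1(n)<0\bigr).$$ If $f$ is twice differentiable on $[0,1]$ with $f''\in C[0,1]$, then $$\lim_{n\to\infty}n\bigl(J_{n,\alpha,\rho}^{M,1}(f;x)-f(x)\bigr)=\frac{(1-2x)\bigl((\rho+2)l_0+(\rho+1)l_1\bigr)}{\rho}f'(x)+\frac{x(1-x)(1+\rho)(2l_0+l_1)}{2\rho}f''(x)$$ uniformly on $[0,1]$.
   Context: Fix $\alpha\in[0,1]$ and $\rho>0$. For $x\in[0,1]$ let $p_{1,0,\alpha}(x)=1-x$, $p_{1,1,\alpha}(x)=x$, and for $m\ge 2$, $0\le k\le m$, $$p_{m,k,\alpha}(x)=\left[\binom{m-2}{k}(1-\alpha)x+\binom{m-2}{k-2}(1-\alpha)(1-x)+\binom{m}{k}\alpha x(1-x)\right]x^{k-1}(1-x)^{m-k-1}$$ (understood as a polynomial in $x$, with $\binom{r}{s}=0$ if $s<0$ or $s>r$); $p_{m,k,\alpha}=0$ if $k<0$ or $k>m$. Let $$\mu_{n,k}^\rho(t)=\frac{t^{k\rho}(1-t)^{(n-k)\rho}}{B(k\rho+1,(n-k)\rho+1)},\quad t\in[0,1],$$ where $B$ is the Beta function. Given real sequences $a_0(n),a_1(n)$, put $a(x,n)=a_1(n)x+a_0(n)$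 and, for $n\ge2$, $$J_{n,\alpha,\rho}^{M,1}(f;x)=\sum_{k=0}^n\bigl[a(x,n)\,p_{n-1,k,\alpha}(x)+a(1-x,n)\,p_{n-1,k-1,\alpha}(x)\bigr]\int_0^1\mu_{n,k}^\rho(t)f(t)\,dt .$$ (In this case the operators need not be positive.) *)

(* Defs.v *)
From HB Require Import structures.
From mathcomp Require Import all_boot all_order all_algebra.
From mathcomp Require Import all_classical all_reals all_analysis.
From mathcomp Require Import ring.
Set Implicit Arguments.
Unset Strict Implicit.
Unset Printing Implicit Defensive.
Import Order.TTheory GRing.Theory Num.Theory.
Import numFieldNormedType.Exports.
Local Open Scope classical_set_scope.
Local Open Scope ring_scope.

(* Binomial coefficient with an integer lower index, 0 when it is negative. *)
Definition binz (r : nat) (s : int) : nat :=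
  match s with Posz j => 'C(r, j) | Negz _ => 0%N end.

(* The bracket of the textbook formula is multiplied out, so that every
   negative power of x or 1 - x is cancelled. Where a natural-number exponent
   below is truncated by subtraction, the binomial coefficient in front of it
   is 0. Lemma alpha_basisE recovers the textbook formula. The case m = 0 is
   never used. *)
Definition alpha_basis (R : realType) (alpha : R) (m : nat) (k : int) (x : R)
    : R :=
  match m, k with
  | 1%N, Posz 0 => 1 - x
  | 1%N, Posz 1 => x
  | r.+2, Posz j =>
      (binz r k)%:R * (1 - alpha) * (x ^+ j * (1 - x) ^+ (m - j - 1))
      + (binz r (k - 2))%:R * (1 - alpha) * (x ^+ (j - 1) * (1 - x) ^+ (m - j))
      + (binz m k)%:R * alpha * (x ^+ j * (1 - x) ^+ (m - j))
  | _, _ => 0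
  end.

Lemma alpha_basisE (R : realType) (alpha : R) (m k : nat) (x : R) :
  (2 <= m)%N -> (k <= m)%N -> x != 0 -> 1 - x != 0 ->
  alpha_basis alpha m k x =
  ((binz (m - 2) k)%:R * (1 - alpha) * x
   + (binz (m - 2) (k%:Z - 2))%:R * (1 - alpha) * (1 - x)
   + (binz m k)%:R * alpha * x * (1 - x))
  * (x ^ (k%:Z - 1)) * ((1 - x) ^ (m%:Z - k%:Z - 1)).
Proof.
case: m => [//|[//|r]] _ kr x0 y0; rewrite subn2 /alpha_basis -!pred_Sn.
set y := 1 - x in y0 *.
have xk : x ^+ k = x * x ^ (k%:Z - 1).
  by rewrite -[X in X * _]expr1z -expfzDr // addrC subrK.
have yk : y ^+ (r.+2 - k) = y * y ^ (r.+2%:Z - k%:Z - 1).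
  by rewrite -[X in X * _]expr1z -expfzDr // addrC subrK subzn.
have t1 : (binz r k)%:R * (y ^+ (r.+2 - k - 1)) =
          (binz r k)%:R * y ^ (r.+2%:Z - k%:Z - 1) :> R.
  case: (leqP k r) => h; last by rewrite /= bin_small // !mul0r.
  have h1 : (k < r.+2)%N by rewrite ltnS leqW.
  by rewrite (subzn kr) subzn // subn_gt0.
have t2 : (binz r (k%:Z - 2))%:R * (x ^+ (k - 1)) =
          (binz r (k%:Z - 2))%:R * x ^ (k%:Z - 1) :> R.
  case: k {kr xk yk t1} => [|j]; first by rewrite !mul0r.
  by rewrite (@subzn j.+1 1).
transitivity ((1 - alpha) * x ^+ k * ((binz r k)%:R * y ^+ (r.+2 - k - 1))
  + (1 - alpha) * y ^+ (r.+2 - k) * ((binz r (k%:Z - 2))%:R * x ^+ (k - 1))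
  + (binz r.+2 k)%:R * alpha * (x ^+ k * y ^+ (r.+2 - k))); first by ring.
by rewrite t1 t2 xk yk; ring.
Qed.

Definition beta_real (R : realType) (a b : R) : R :=
  \int[lebesgue_measure]_(t in `[0, 1]) (t `^ (a - 1) * (1 - t) `^ (b - 1)).

Definition mu_kernel (R : realType) (rho : R) (n k : nat) (t : R) : R :=
  (t `^ (k%:R * rho) * (1 - t) `^ ((n - k)%:R * rho))
  / beta_real (k%:R * rho + 1) ((n - k)%:R * rho + 1).

Definition JM1 (R : realType) (alpha rho : R) (a0 a1 : nat -> R) (n : nat)
    (f : R -> R) (x : R) : R :=
  let a (y : R) := a1 n * y + a0 n in
  \sum_(k < n.+1)
    (a x * alpha_basis alpha (n - 1) k x
     + a (1 - x) * alpha_basis alpha (n - 1) (k%:Z - 1) x)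
    * \int[lebesgue_measure]_(t in `[0, 1]) (mu_kernel rho n k t * f t).

(* The difference quotient only sees points of A, so at an endpoint of a
   closed interval this is the one-sided derivative. *)
Definition has_derivative_on (R : realType) (A : set R) (f f' : R -> R) : Prop :=
  forall x, A x ->
    (fun y => (f y - f x) / (y - x)) @ within A (dnbhs x) --> f' x.

(* Main.v *)
Require Import Defs.
From mathcomp Require Import all_boot all_order all_algebra.
From mathcomp Require Import all_classical all_reals all_analysis.
From mathcomp Require Import ring lra.
Import Order.TTheory GRing.Theory Num.Theory.
Import numFieldNormedType.Exports.
Local Open Scope classical_set_scope.
Local Open Scope ring_scope.

(** The operator sends [f] to a combination, over [k], of the means [L_k f] of
    [f] under the Beta densities [mu_kernel rho n k], with weights of total
    mass [a(x,n) + a(1-x,n) = 2 a0 n + a1 n = 1] that may change sign. The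
    theorem follows by replacing [f] by its Taylor polynomial of degree 2 at
    [x], computing the moments of order 1 and 2 exactly, and bounding the
    remainder by a moment of order 4.

    The exact part ([scaled_moments]). The relation [a1 n = 1 - 2 * a0 n] turns
    the two factors into [a(x,n) = x + a0 n * (1 - 2x)] and
    [a(1-x,n) = 1 - x - a0 n * (1 - 2x)]. The scaled first moment is then
    [(1 - 2x) * u n] and the scaled second moment [x (1-x) * p n + q n], with
    sequences [u], [p], [q] that do not involve [x]. So this part converges
    uniformly as soon as three numerical sequences converge.

    The remainder ([mod_mean_remainder_le]). By the mean value theorem, used
    twice, and the uniform continuity of [f''], the Taylor remainder is at most
    [e (t-x)^2 + K (t-x)^4] with [e] as small as desired ([taylor2]). Since
    [(t-x)^2 <= 1/(2n) + (n/2) (t-x)^4], a bound in [1/n^2] on the fourth moment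
    is all that is needed, and [n] times the remainder is then of order
    [e + K/n]. The weights are replaced by nonnegative ones, with [`|a(x,n)|]
    and [`|a(1-x,n)|] in place of [a(x,n)] and [a(1-x,n)]. These factors stay
    bounded because [a0] converges.

    The fourth moment. With [m] the mean of the [k]-th Beta density, write
    [t - x = (t - m) + (m - x)]. The fourth power of the first term has Beta mean
    at most [3/s^2], where [s = n rho + 2] ([beta_mean_central4_le]). The second
    is an affine function of [k - n x] divided by [s], and the weights
    [alpha_basis] are mixtures of shifted binomial distributions with parameters
    [n - 3] or [n - 1] and [x], so the fourth binomial moment ([bern_mean_central])
    concludes. *)

(** * Moments of the binomial distribution *)

Definition bern_mean {R : realType} (N : nat) (x : R) (g : nat -> R) : R :=
  \sum_(j < N.+1) 'C(N, j)%:R * (x ^+ j * (1 - x) ^+ (N - j)) * g j.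

Lemma eq_bern_mean {R : realType} (N : nat) (x : R) (g h : nat -> R) :
  (forall j, (j <= N)%N -> g j = h j) -> bern_mean N x g = bern_mean N x h.
Proof. by move=> gh; apply: eq_bigr => j _; rewrite gh// -ltnS. Qed.

Lemma le_bern_mean {R : realType} (N : nat) (x : R) (g h : nat -> R) :
  0 <= x <= 1 -> (forall j, (j <= N)%N -> g j <= h j) ->
  bern_mean N x g <= bern_mean N x h.
Proof.
move=> /andP[x0 x1] gh; apply: ler_sum => j _.
apply: ler_wpM2l; last by apply: gh; rewrite -ltnS.
by rewrite !mulr_ge0// exprn_ge0// subr_ge0.
Qed.

Lemma bern_meanD {R : realType} (N : nat) (x : R) (g h : nat -> R) :
  bern_mean N x (fun j => g j + h j) = bern_mean N x g + bern_mean N x h.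
Proof. by rewrite -big_split; apply: eq_bigr => j _; rewrite mulrDr. Qed.

Lemma bern_meanZ {R : realType} (N : nat) (x z : R) (g : nat -> R) :
  bern_mean N x (fun j => z * g j) = z * bern_mean N x g.
Proof. by rewrite big_distrr; apply: eq_bigr => j _ /=; rewrite mulrCA. Qed.

(** Pascal's rule: one more trial either fails or shifts the count by one. This
    makes every moment computation an induction on the number of trials. *)
Lemma bern_mean_rec {R : realType} (N : nat) (x : R) (g : nat -> R) :
  bern_mean N.+1 x g = (1 - x) * bern_mean N x g + x * bern_mean N x (fun j => g j.+1).
Proof.
rewrite /bern_mean big_ord_recl /= bin0 subn0 expr0 !mul1r.
under eq_bigr => j _ do
  rewrite /bump leq0n add1n subSS binS natrD mulrDl mulrDl.
rewrite big_split /= addrA; congr (_ + _); last first.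
  by rewrite big_distrr; apply: eq_bigr => j _ /=; rewrite exprS; ring.
rewrite big_ord_recr /= bin_small// !mul0r addr0.
rewrite big_ord_recl /= bin0 subn0 expr0 !mul1r mulrDr exprS mulrA; congr (_ + _).
rewrite big_distrr; apply: eq_bigr => j _ /=.
by rewrite /bump leq0n add1n -(@subnSK j N)// [(1 - x) ^+ _.+1]exprS; ring.
Qed.

(** The induction on [N] needs all lower moments together with the fourth one,
    since passing from [N] to [N.+1] translates the centre; hence one statement
    about an arbitrary polynomial of degree 4. *)
Lemma bern_mean_central {R : realType} (N : nat) (x c0 c1 c2 c3 c4 : R) :
  bern_mean N x (fun j => let d := j%:R - N%:R * x in
     c0 + c1 * d + c2 * d ^+ 2 + c3 * d ^+ 3 + c4 * d ^+ 4)
  = let V := N%:R * (x * (1 - x)) in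
    c0 + c2 * V + c3 * V * (1 - 2 * x)
    + c4 * (3 * V ^+ 2 + V * (1 - 6 * (x * (1 - x)))).
Proof.
elim: N c0 c1 c2 c3 c4 => [|N IH] c0 c1 c2 c3 c4 /=.
  rewrite /bern_mean big_ord1 bin0 subnn !expr0 /= mul0r subr0; ring.
rewrite bern_mean_rec.
(* The translated polynomial, expanded around the centre for [N] trials. *)
pose s (y z0 z1 z2 z3 z4 : R) (j : nat) : R := let d := j%:R - N%:R * x in
     (z0 + z1 * y + z2 * y ^+ 2 + z3 * y ^+ 3 + z4 * y ^+ 4)
     + (z1 + 2 * z2 * y + 3 * z3 * y ^+ 2 + 4 * z4 * y ^+ 3) * d
     + (z2 + 3 * z3 * y + 6 * z4 * y ^+ 2) * d ^+ 2
     + (z3 + 4 * z4 * y) * d ^+ 3 + z4 * d ^+ 4.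
have sE y d z0 z1 z2 z3 z4 : z0 + z1 * (d + y) + z2 * (d + y) ^+ 2
    + z3 * (d + y) ^+ 3 + z4 * (d + y) ^+ 4 =
     (z0 + z1 * y + z2 * y ^+ 2 + z3 * y ^+ 3 + z4 * y ^+ 4)
     + (z1 + 2 * z2 * y + 3 * z3 * y ^+ 2 + 4 * z4 * y ^+ 3) * d
     + (z2 + 3 * z3 * y + 6 * z4 * y ^+ 2) * d ^+ 2
     + (z3 + 4 * z4 * y) * d ^+ 3 + z4 * d ^+ 4 :> R by ring.
rewrite (@eq_bern_mean _ _ _ _ (s (- x) c0 c1 c2 c3 c4)); last first.
  move=> j _; rewrite /s -sE.
  by have -> : j%:R - N.+1%:R * x = j%:R - N%:R * x + - x by rewrite -natr1; ring.
rewrite [X in _ + x * X](@eq_bern_mean _ _ _ _ (s (1 - x) c0 c1 c2 c3 c4)); last first.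
  move=> j _; rewrite /s -sE.
  by have -> : j.+1%:R - N.+1%:R * x = j%:R - N%:R * x + (1 - x) by rewrite -!natr1; ring.
rewrite /s !IH /= -[N.+1%:R]natr1; move: (N%:R) => M; clear.
ring.
Qed.

Lemma expr4D_le {R : realType} (d e : R) : (d + e) ^+ 4 <= 8 * (d ^+ 4 + e ^+ 4).
Proof.
rewrite -subr_ge0.
have -> : 8 * (d ^+ 4 + e ^+ 4) - (d + e) ^+ 4
    = (d - e) ^+ 2 * (5 * (d + e) ^+ 2 + 2 * (d ^+ 2 + e ^+ 2)) by ring.
rewrite mulr_ge0 ?sqr_ge0//.
by have := sqr_ge0 (d + e); have := sqr_ge0 d; have := sqr_ge0 e; lra.
Qed.

Lemma bern_mean_deg2 {R : realType} (N : nat) (x y c0 c1 c2 : R) :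
  bern_mean N x (fun j => c0 + c1 * (j%:R - y) + c2 * (j%:R - y) ^+ 2)
  = c0 + c1 * (N%:R * x - y)
    + c2 * (N%:R * (x * (1 - x)) + (N%:R * x - y) ^+ 2).
Proof.
pose e := N%:R * x - y.
transitivity (bern_mean N x (fun j => let d := j%:R - N%:R * x in
    (c0 + c1 * e + c2 * e ^+ 2) + (c1 + 2 * c2 * e) * d + c2 * d ^+ 2
    + 0 * d ^+ 3 + 0 * d ^+ 4)).
  by apply: eq_bern_mean => j _; rewrite /e /=; ring.
by rewrite bern_mean_central /= /e; ring.
Qed.

(** The hypothesis allows for the distance between the mean of each binomial
    law of the mixture and the common centre [n x] of all of them, which is at
    most 3 after the shifts are taken into account. *)
Lemma bern_mean_pow4_le {R : realType} (N n : nat) (x y : R) :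
  0 <= x <= 1 -> (N <= n)%N -> (0 < n)%N -> `|N%:R * x - y| <= 3 ->
  bern_mean N x (fun j => (j%:R - y) ^+ 4) <= 652 * n%:R ^+ 2.
Proof.
move=> x01 Nn n0; set e := N%:R * x - y => eb.
have /andP[x0 x1] := x01.
have e4 : e ^+ 4 <= 81.
  rewrite -[e ^+ 4]ger0_norm ?exprn_even_ge0// normrX.
  have := @lerXn2r R 4 `|e| 3; rewrite !nnegrE normr_ge0 ler0n => /(_ isT isT eb).
  by move=> h; apply: le_trans h _; rewrite -natrX ler_nat.
(* [648 = 8 * 3 ^ 4] comes from the off-centre part. *)
apply: (@le_trans _ _ (bern_mean N x (fun j => let d := j%:R - N%:R * x in
    648 + 0 * d + 0 * d ^+ 2 + 0 * d ^+ 3 + 8 * d ^+ 4))).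
  apply: le_bern_mean => // j _ /=; set d := j%:R - N%:R * x.
  have -> : j%:R - y = d + e by rewrite /d /e; ring.
  by have := expr4D_le d e; lra.
rewrite bern_mean_central /=.
have n1 : 1 <= n%:R :> R by rewrite ler1n.
have Nn' : N%:R <= n%:R :> R by rewrite ler_nat.
have N0 : 0 <= N%:R :> R by rewrite ler0n.
have X0 : 0 <= x * (1 - x) by nra.
have X1 : 4 * (x * (1 - x)) <= 1 by have := sqr_ge0 (1 - 2 * x); nra.
set X := x * (1 - x) in X0 X1 *.
have V0 : 0 <= N%:R * X by rewrite mulr_ge0.
have V1 : 4 * (N%:R * X) <= n%:R by nra.
set V := N%:R * X in V0 V1 *.
have : V * (1 - 6 * X) <= V by nra.
have : 16 * V ^+ 2 <= n%:R ^+ 2 by nra.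
have : n%:R <= n%:R ^+ 2 :> R by nra.
have : 1 <= n%:R ^+ 2 :> R by nra.
lra.
Qed.

(** * Mixtures of shifted binomial distributions *)

(** The weights [alpha_basis alpha r.+2 k x] are a mixture of three binomial
    laws: one on [r] trials, the same one shifted by 2, and one on [r.+2] trials.
    This functional is the corresponding mixture of expectations. *)
Definition alpha_mean {R : realType} (alpha : R) (r : nat) (x : R) (g : nat -> R) : R :=
  (1 - alpha) * ((1 - x) * bern_mean r x g + x * bern_mean r x (fun j => g j.+2))
  + alpha * bern_mean r.+2 x g.

Lemma eq_alpha_mean {R : realType} (alpha : R) (r : nat) (x : R) (g h : nat -> R) :
  (forall k, (k <= r.+2)%N -> g k = h k) ->
  alpha_mean alpha r x g = alpha_mean alpha r x h.
Proof.
move=> gh; rewrite /alpha_mean; congr (_ * (_ * _ + _ * _) + _ * _);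
  by apply: eq_bern_mean => j jr; rewrite gh// 2?leqW.
Qed.

Lemma alpha_meanD {R : realType} (alpha : R) (r : nat) (x : R) (g h : nat -> R) :
  alpha_mean alpha r x (fun k => g k + h k) = alpha_mean alpha r x g + alpha_mean alpha r x h.
Proof. by rewrite /alpha_mean !bern_meanD; ring. Qed.

Lemma alpha_meanZ {R : realType} (alpha : R) (r : nat) (x z : R) (g : nat -> R) :
  alpha_mean alpha r x (fun k => z * g k) = z * alpha_mean alpha r x g.
Proof. by rewrite /alpha_mean !bern_meanZ; ring. Qed.

Lemma le_alpha_mean {R : realType} (alpha : R) (r : nat) (x : R) (g h : nat -> R) :
  0 <= alpha <= 1 -> 0 <= x <= 1 -> (forall k, (k <= r.+2)%N -> g k <= h k) ->
  alpha_mean alpha r x g <= alpha_mean alpha r x h.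
Proof.
move=> /andP[a0 a1] x01 gh; have /andP[x0 x1] := x01.
apply: lerD.
  apply: ler_wpM2l; first by rewrite subr_ge0.
  apply: lerD; (apply: ler_wpM2l; first by rewrite ?subr_ge0);
    apply: le_bern_mean => // j jr; apply: gh; rewrite ?ltnS//.
  by rewrite (leq_trans jr)// leqW.
by apply: ler_wpM2l => //; apply: le_bern_mean.
Qed.

Lemma sum_alpha_basis {R : realType} (alpha : R) (r : nat) (x : R) (g : nat -> R) :
  \sum_(k < r.+3) alpha_basis alpha r.+2 k x * g k = alpha_mean alpha r x g.
Proof.
rewrite /alpha_basis.
under eq_bigr => k _ do rewrite mulrDl mulrDl.
rewrite !big_split /= /alpha_mean mulrDr; congr (_ + _ + _).
- rewrite 2!big_ord_recr /= !bin_small// !mul0r !addr0.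
  rewrite /bern_mean mulrA big_distrr; apply: eq_bigr => j _ /=.
  have -> : (r.+2 - j - 1 = (r - j).+1)%N.
    have jr : (j <= r)%N by rewrite -ltnS.
    by rewrite subn1 subSn ?(leqW jr)//= subSn.
  by rewrite [_ ^+ _.+1]exprS; ring.
- rewrite 2!big_ord_recl /= !mul0r !add0r.
  rewrite /bern_mean mulrA big_distrr; apply: eq_bigr => j _ /=.
  rewrite /bump !leq0n !add1n !subSS subn0.
  by rewrite exprS; ring.
- by rewrite /bern_mean big_distrr; apply: eq_bigr => j _ /=; ring.
Qed.

Lemma alpha_mean_deg2 {R : realType} (alpha : R) (r : nat) (x y c0 c1 c2 : R) :
  alpha_mean alpha r x (fun k => c0 + c1 * (k%:R - y) + c2 * (k%:R - y) ^+ 2)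
  = c0 + c1 * (r.+2%:R * x - y)
    + c2 * ((r.+2%:R + 2 * (1 - alpha)) * (x * (1 - x)) + (r.+2%:R * x - y) ^+ 2).
Proof.
rewrite /alpha_mean !bern_mean_deg2.
rewrite (@eq_bern_mean _ _ _ _ (fun j => c0 + c1 * (j%:R - (y - 2))
    + c2 * (j%:R - (y - 2)) ^+ 2)).
  by rewrite bern_mean_deg2 -[r.+2]addn2 natrD; ring.
by move=> j _; rewrite -[j.+2]addn2 natrD; ring.
Qed.

Lemma alpha_mean_pow4_le {R : realType} (alpha : R) (r : nat) (x y : R) :
  0 <= alpha <= 1 -> 0 <= x <= 1 -> r.+3%:R * x - 1 <= y <= r.+3%:R * x ->
  alpha_mean alpha r x (fun k => (k%:R - y) ^+ 4) <= 652 * r.+3%:R ^+ 2.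
Proof.
move=> /andP[al0 al1] x01 yb; have /andP[x0 x1] := x01.
have rE : r.+3%:R = r%:R + 3 :> R by rewrite -natrD addn3.
have rE2 : r.+2%:R = r%:R + 2 :> R by rewrite -natrD addn2.
have b1 : bern_mean r x (fun k => (k%:R - y) ^+ 4) <= 652 * r.+3%:R ^+ 2.
  apply: bern_mean_pow4_le => //; first by rewrite 2?ltnW.
  by move: yb; rewrite rE ler_norml => /andP[]; lra.
have b2 : bern_mean r x (fun k => (k.+2%:R - y) ^+ 4) <= 652 * r.+3%:R ^+ 2.
  rewrite (@eq_bern_mean _ _ _ _ (fun j => (j%:R - (y - 2)) ^+ 4)); last first.
    by move=> j _; rewrite -[j.+2]addn2 natrD; ring.
  apply: bern_mean_pow4_le => //; first by rewrite 2?ltnW.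
  by move: yb; rewrite rE ler_norml => /andP[]; lra.
have b3 : bern_mean r.+2 x (fun k => (k%:R - y) ^+ 4) <= 652 * r.+3%:R ^+ 2.
  apply: bern_mean_pow4_le => //.
  by move: yb; rewrite rE rE2 ler_norml => /andP[]; lra.
set Z := 652 * _ in b1 b2 b3 *.
have -> : Z = (1 - alpha) * ((1 - x) * Z + x * Z) + alpha * Z by ring.
by apply: lerD; rewrite ler_wpM2l ?subr_ge0// lerD// ler_wpM2l ?subr_ge0.
Qed.

(** The weights of the modified operator, with [A] standing for [a(x,n)] and [B]
    for [a(1-x,n)]. They are kept free because the functional is also used with
    [`|A|] and [`|B|], where it is positive. *)
Definition mod_mean {R : realType} (alpha A B : R) (r : nat) (x : R) (g : nat -> R) : R :=
  A * alpha_mean alpha r x g + B * alpha_mean alpha r x (fun k => g k.+1).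

Lemma mod_meanD {R : realType} (alpha A B : R) (r : nat) (x : R) (g h : nat -> R) :
  mod_mean alpha A B r x (fun k => g k + h k)
  = mod_mean alpha A B r x g + mod_mean alpha A B r x h.
Proof. by rewrite /mod_mean !alpha_meanD; ring. Qed.

Lemma mod_meanZ {R : realType} (alpha A B : R) (r : nat) (x z : R) (g : nat -> R) :
  mod_mean alpha A B r x (fun k => z * g k) = z * mod_mean alpha A B r x g.
Proof. by rewrite /mod_mean !alpha_meanZ; ring. Qed.

Lemma eq_mod_mean {R : realType} (alpha A B : R) (r : nat) (x : R) (g h : nat -> R) :
  (forall k, (k <= r.+3)%N -> g k = h k) ->
  mod_mean alpha A B r x g = mod_mean alpha A B r x h.
Proof.
by move=> gh; congr (_ * _ + _ * _); apply: eq_alpha_mean => k kr; rewrite gh// leqW.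
Qed.

(** This replaces positivity, which the operator itself may lack. *)
Lemma le_normr_mod_mean {R : realType} (alpha A B : R) (r : nat) (x : R)
    (g h : nat -> R) :
  0 <= alpha <= 1 -> 0 <= x <= 1 -> (forall k, (k <= r.+3)%N -> `|g k| <= h k) ->
  `|mod_mean alpha A B r x g| <= mod_mean alpha `|A| `|B| r x h.
Proof.
move=> al x01 gh.
have H (g' h' : nat -> R) : (forall k, (k <= r.+2)%N -> `|g' k| <= h' k) ->
    `|alpha_mean alpha r x g'| <= alpha_mean alpha r x h'.
  move=> gh'; rewrite ler_norml -mulN1r -alpha_meanZ; apply/andP; split;
    apply: le_alpha_mean => // k kr; have := gh' _ kr; rewrite ler_norml => /andP[];
    by rewrite ?mulN1r.
rewrite /mod_mean (le_trans (ler_normD _ _))// !normrM.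
by apply: lerD; apply: ler_wpM2l => //; apply: H => k kr; apply: gh; rewrite // leqW.
Qed.

Lemma mod_mean_deg2 {R : realType} (alpha A B : R) (r : nat) (x c0 c1 c2 : R) :
  A + B = 1 ->
  mod_mean alpha A B r x (fun k => let d := k%:R - r.+3%:R * x in
    c0 + c1 * d + c2 * d ^+ 2)
  = c0 + c1 * (B - x)
    + c2 * ((r.+2%:R + 2 * (1 - alpha)) * (x * (1 - x))
            + A * x ^+ 2 + B * (1 - x) ^+ 2).
Proof.
move=> AB; rewrite /mod_mean alpha_mean_deg2.
rewrite (@eq_alpha_mean _ _ _ _ _ (fun k => c0 + c1 * (k%:R - (r.+3%:R * x - 1))
    + c2 * (k%:R - (r.+3%:R * x - 1)) ^+ 2)); last first.
  by move=> k _; rewrite -[k.+1%:R]natr1; ring.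
rewrite alpha_mean_deg2 -[r.+3%:R]natr1; move: (r.+2%:R) => m.
have -> : B = 1 - A by rewrite -AB; ring.
ring.
Qed.

Lemma mod_mean_pow4_le {R : realType} (alpha A B : R) (r : nat) (x p q : R) :
  0 <= alpha <= 1 -> 0 <= x <= 1 -> 0 <= A -> 0 <= B -> 0 <= q ->
  mod_mean alpha A B r x (fun k => p + q * (k%:R - r.+3%:R * x) ^+ 4)
  <= (A + B) * (p + q * (652 * r.+3%:R ^+ 2)).
Proof.
move=> al x01 A0 B0 q0.
have cst : alpha_mean alpha r x (fun _ => p) = p.
  have := alpha_mean_deg2 alpha r x 0 p 0 0; rewrite !mul0r !addr0 => E.
  by rewrite -[RHS]E; apply: eq_alpha_mean => k _; rewrite !mul0r !addr0.
rewrite mod_meanD mod_meanZ {1}/mod_mean !cst -mulrDl [leRHS]mulrDr lerD2l mulrCA ler_wpM2l// /mod_mean [leRHS]mulrDl.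
apply: lerD; apply: ler_wpM2l => //.
  by apply: alpha_mean_pow4_le => //; apply/andP; split; lra.
rewrite (@eq_alpha_mean _ _ _ _ _ (fun k => (k%:R - (r.+3%:R * x - 1)) ^+ 4)).
  by apply: alpha_mean_pow4_le => //; apply/andP; split; lra.
by move=> k _; rewrite -[k.+1%:R]natr1; congr (_ ^+ _); ring.
Qed.

Lemma sum_alpha_basisS {R : realType} (alpha : R) (r : nat) (x : R) (g : nat -> R) :
  \sum_(k < r.+4) alpha_basis alpha r.+2 k x * g k = alpha_mean alpha r x g.
Proof.
rewrite big_ord_recr sum_alpha_basis.
have E : alpha_basis alpha r.+2 r.+3 x = 0.
  have r3 : (r < r.+3)%N by rewrite ltnS leqW.
  by rewrite /alpha_basis /= !bin_small// !mul0r !addr0.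
by rewrite /= [X in X * _]E mul0r addr0.
Qed.

Lemma sum_alpha_basis_pred {R : realType} (alpha : R) (r : nat) (x : R)
    (g : nat -> R) :
  \sum_(k < r.+4) alpha_basis alpha r.+2 (k%:Z - 1) x * g k
  = alpha_mean alpha r x (fun k => g k.+1).
Proof.
rewrite big_ord_recl -sum_alpha_basis.
rewrite -[RHS]add0r; congr (_ + _); first by rewrite /alpha_basis /= mul0r.
apply: eq_bigr => j _.
by have -> : Posz (lift ord0 j) - 1 = Posz j
  by rewrite lift0 -addn1 PoszD addrK.
Qed.

(** * Functions continuous on the unit interval *)

(** Continuity is required on the interval only: [t `^ c] is [1] for negative
    [t], so the Beta weights are in general discontinuous at the endpoints as
    functions on the whole line. *)
Notation cont01 g := ({within `[0, 1], continuous g}).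

Lemma cont01_of_continuous {R : realType} (g : R -> R) :
  continuous g -> cont01 g.
Proof. exact: continuous_subspaceT. Qed.

Lemma cont01_id {R : realType} : cont01 (fun t : R => t).
Proof. by apply: cont01_of_continuous => t; exact: cvg_id. Qed.

Lemma cont01_cst {R : realType} (z : R) : cont01 (fun _ : R => z).
Proof. by apply: cont01_of_continuous => t; exact: cvg_cst. Qed.

Lemma cont01D {R : realType} (g h : R -> R) :
  cont01 g -> cont01 h -> cont01 (fun t => g t + h t).
Proof. by move=> cg ch t; apply: continuousD; [exact: cg|exact: ch]. Qed.

Lemma cont01M {R : realType} (g h : R -> R) :
  cont01 g -> cont01 h -> cont01 (fun t => g t * h t).
Proof. by move=> cg ch t; apply: continuousM; [exact: cg|exact: ch]. Qed.

Lemma cont01_pow {R : realType} (x : R) (q : nat) : cont01 (fun t : R => (t - x) ^+ q).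
Proof.
elim: q => [|q IH]; first exact: cont01_cst.
have -> : (fun t : R => (t - x) ^+ q.+1) = (fun t => (t - x) * (t - x) ^+ q).
  by apply/funext => t; rewrite exprS.
apply: cont01M => //; apply: cont01D; [exact: cont01_id | exact: cont01_cst].
Qed.

Lemma cont01_integrable {R : realType} (g : R -> R) : cont01 g ->
  (@lebesgue_measure R).-integrable `[0, 1] (EFin \o g).
Proof.
by move=> cg; apply: continuous_compact_integrable => //; exact: segment_compact.
Qed.

(** * Means under Beta densities *)

Lemma int01Z {R : realType} (z : R) (g : R -> R) : cont01 g ->
  \int[lebesgue_measure]_(t in `[0, 1]) (z * g t)
  = z * \int[lebesgue_measure]_(t in `[0, 1]) g t.
Proof. by move=> cg; apply: RintegralZl => //; exact: cont01_integrable. Qed.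

Lemma int01D {R : realType} (g h : R -> R) : cont01 g -> cont01 h ->
  \int[lebesgue_measure]_(t in `[0, 1]) (g t + h t)
  = \int[lebesgue_measure]_(t in `[0, 1]) g t
    + \int[lebesgue_measure]_(t in `[0, 1]) h t.
Proof. by move=> cg ch; apply: RintegralD => //; exact: cont01_integrable. Qed.

Lemma powR_cvg_at0 {R : realType} (c : R) : 0 <= c ->
  (fun t => t `^ c) @ (0:R)^'+ --> 0 `^ c.
Proof.
rewrite le_eqVlt => /predU1P[<-|c0].
  by rewrite powRr0; under eq_fun do rewrite powRr0; exact: cvg_cst.
by rewrite powR0 ?gt_eqF//; exact: powR_cvg0.
Qed.

Lemma powR_continuous {R : realType} (c t : R) : 0 < t ->
  {for t, continuous (fun t => t `^ c)}.
Proof.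
move=> t0; apply/differentiable_continuous/derivable1_diffP.
by apply: derivable_powR; rewrite in_itv/= t0.
Qed.

Lemma powR_LRcontinuous {R : realType} (c : R) : 0 <= c ->
  derivable_oo_LRcontinuous (fun t : R => t `^ c) 0 1.
Proof.
move=> c0; split.
- move=> t; rewrite in_itv /= => /andP[t0 _].
  by apply: derivable_powR; rewrite in_itv/= t0.
- exact: powR_cvg_at0.
- by apply: cvg_at_left_filter; exact: powR_continuous.
Qed.

Lemma cvg_onem_left {R : realType} : (fun t : R => 1 - t) @ 1^'- --> (0:R)^'+.
Proof.
move=> P [e /= e0 He]; exists e => //= t /= te t1.
by apply: He => /=; [rewrite sub0r normrN | rewrite subr_gt0].
Qed.

Lemma is_derive_powR_onem {R : realType} (c t : R) : t < 1 ->
  is_derive t 1 (fun t : R => (1 - t) `^ c) (- (c * (1 - t) `^ (c - 1))).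
Proof.
move=> t1; rewrite -[X in is_derive _ _ _ X]mulrN1.
have -> : (fun t : R => (1 - t) `^ c) = (fun y => y `^ c) \o (fun t => 1 - t) by [].
have D : is_derive t 1 (fun t : R => 1 - t) (-1) by rewrite -[-1]sub0r; apply: is_deriveB.
apply: is_derive1_comp => //=. apply: is_derive1_powR; rewrite subr_gt0//.
Qed.

Lemma powR_onem_LRcontinuous {R : realType} (c : R) : 0 <= c ->
  derivable_oo_LRcontinuous (fun t : R => (1 - t) `^ c) 0 1.
Proof.
move=> c0; split.
- move=> t; rewrite in_itv /= => /andP[_ t1].
  exact: (@ex_derive _ _ _ _ _ _ _ (is_derive_powR_onem _ _ t1)).
- apply: cvg_at_right_filter.
  suff : {for 0, continuous (fun t : R => (1 - t) `^ c)} by [].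
  apply/differentiable_continuous/derivable1_diffP.
  exact: (@ex_derive _ _ _ _ _ _ _ (is_derive_powR_onem _ _ ltr01)).
- rewrite subrr.
  exact: (@cvg_comp _ _ _ (fun t : R => 1 - t) (fun y => y `^ c) _ _ _
    cvg_onem_left (powR_cvg_at0 _ c0)).
Qed.

Definition beta_weight {R : realType} (c d t : R) : R := t `^ c * (1 - t) `^ d.

Lemma beta_weight_cont {R : realType} (c d : R) : 0 <= c -> 0 <= d -> cont01 (beta_weight c d).
Proof.
move=> c0 d0; apply: cont01M; apply: derivable_oo_LRcontinuous_within.
  exact: powR_LRcontinuous.
exact: powR_onem_LRcontinuous.
Qed.

Lemma beta_weight_ge0 {R : realType} (c d t : R) : 0 <= beta_weight c d t.
Proof. by rewrite mulr_ge0 ?powR_ge0. Qed.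

(** Integration by parts of [t `^ (c+1)] against the derivative of
    [(1-t) `^ (d+1)]; both boundary terms vanish. *)
Lemma beta_parts {R : realType} (c d : R) : 0 <= c -> 0 <= d ->
  (d + 1) * (\int[lebesgue_measure]_(t in `[0, 1]) beta_weight (c + 1) d t) =
  (c + 1) * (\int[lebesgue_measure]_(t in `[0, 1]) beta_weight c (d + 1) t).
Proof.
move=> c0 d0.
have c1 : 0 <= c + 1 by rewrite addr_ge0.
have d1 : 0 <= d + 1 by rewrite addr_ge0.
have h1 : cont01 (fun t : R => (c + 1) * t `^ c).
  apply: cont01M; first exact: cont01_cst.
  by apply: derivable_oo_LRcontinuous_within; exact: powR_LRcontinuous.
have h2 : {in `]0, 1[, (fun t : R => t `^ (c + 1))^`()%classic =1 (fun t => (c + 1) * t `^ c)}.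
  move=> t; rewrite in_itv /= => /andP[t0 _].
  by rewrite powR_derive1 ?in_itv/= ?t0// addrK.
have h3 : cont01 (fun t : R => - ((d + 1) * (1 - t) `^ d)).
  have -> : (fun t : R => - ((d + 1) * (1 - t) `^ d))
      = (fun t => - (d + 1) * (1 - t) `^ d).
    by apply/funext => t; rewrite mulNr.
  apply: cont01M; first exact: cont01_cst.
  by apply: derivable_oo_LRcontinuous_within; exact: powR_onem_LRcontinuous.
have h4 : {in `]0, 1[, (fun t : R => (1 - t) `^ (d + 1))^`()%classic =1
    (fun t => - ((d + 1) * (1 - t) `^ d))}.
  move=> t; rewrite in_itv /= => /andP[_ t1].
  rewrite derive1E.
  by rewrite (@derive_val _ _ _ _ _ _ _ (is_derive_powR_onem _ _ t1)) addrK.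
have := Rintegration_by_parts ltr01 h1 (powR_LRcontinuous _ c1) h2 h3 (powR_onem_LRcontinuous _ d1) h4.
have c1n : c + 1 != 0 by rewrite gt_eqF// ltr_wpDl.
have d1n : d + 1 != 0 by rewrite gt_eqF// ltr_wpDl.
rewrite subrr (powR0 c1n) (powR0 d1n) mulr0 mul0r subrr sub0r.
have -> : (fun t : R => t `^ (c + 1) * - ((d + 1) * (1 - t) `^ d))
   = (fun t => - (d + 1) * beta_weight (c + 1) d t).
  by apply/funext => t; rewrite /beta_weight; ring.
have -> : (fun t : R => (c + 1) * t `^ c * (1 - t) `^ (d + 1))
   = (fun t => (c + 1) * beta_weight c (d + 1) t).
  by apply/funext => t; rewrite /beta_weight; ring.
rewrite (int01Z _ _ (beta_weight_cont _ _ c1 d0)) (int01Z _ _ (beta_weight_cont _ _ c0 d1)).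
by rewrite mulNr => /oppr_inj.
Qed.

(** The exponents are those of the weight, so the Beta law has parameters
    [c + 1] and [d + 1]. *)
Definition beta_mean {R : realType} (c d : R) (g : R -> R) : R :=
  \int[lebesgue_measure]_(t in `[0, 1]) (beta_weight c d t / beta_real (c + 1) (d + 1) * g t).

Lemma beta_realE {R : realType} (c d : R) :
  beta_real (c + 1) (d + 1) = \int[lebesgue_measure]_(t in `[0, 1]) beta_weight c d t.
Proof. by rewrite /beta_real !addrK. Qed.

Lemma beta_weight_shift {R : realType} (c d t : R) : 0 <= c -> 0 <= t ->
  t * beta_weight c d t = beta_weight (c + 1) d t.
Proof.
move=> c0 t0; rewrite /beta_weight mulrA -(@mulr_powRB1 _ t (c + 1)) ?addrK//.
by rewrite ltr_wpDl.
Qed.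

Lemma beta_weight_shiftr {R : realType} (c d t : R) : 0 <= d -> t <= 1 ->
  (1 - t) * beta_weight c d t = beta_weight c (d + 1) t.
Proof.
move=> d0 t1; rewrite /beta_weight mulrCA -(@mulr_powRB1 _ (1 - t) (d + 1)) ?addrK//.
  by rewrite subr_ge0.
by rewrite ltr_wpDl.
Qed.

(** On the interval the weight dominates [t ^+ N * (1 - t) ^+ N] for a natural
    number [N] above both exponents, which reduces positivity to the Beta
    function at positive integers. *)
Lemma beta_real_gt0 {R : realType} (c d : R) : 0 <= c -> 0 <= d ->
  0 < beta_real (c + 1) (d + 1).
Proof.
move=> c0 d0; rewrite beta_realE.
pose N := (Num.bound (c + d)).+1.
have cdN : c + d <= N%:R.
  by rewrite (le_trans (ltW (archi_boundP (addr_ge0 c0 d0))))// ler_nat.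
have pow_le (t e : R) : 0 <= t <= 1 -> e <= N%:R -> t ^+ N <= t `^ e.
  move=> /andP[t0 t1] eN; rewrite -powR_mulrn//.
  move: t0; rewrite le_eqVlt => /predU1P[<-|t0].
    by rewrite powR0 ?powR_ge0// pnatr_eq0.
  by apply: ger_powR => //; rewrite t0.
apply: (lt_le_trans (beta_fun_gt0 N.+1 N.+1)).
rewrite /beta_fun -Rintegral_mkcond; apply: le_Rintegral => //.
- exact: integrable_XMonemX.
- exact/cont01_integrable/beta_weight_cont.
- move=> t /=; rewrite in_itv/= => t01; have /andP[t0 t1] := t01.
  have u01 : 0 <= 1 - t <= 1 by rewrite subr_ge0 t1 gerBl.
  have cN : c <= N%:R by apply: le_trans cdN; rewrite lerDl.
  have dN : d <= N%:R by apply: le_trans cdN; rewrite lerDr.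
  have /andP[u0 _] := u01.
  exact: (ler_pM (exprn_ge0 N t0) (exprn_ge0 N u0) (pow_le t c t01 cN)
    (pow_le (1 - t) d u01 dN)).
Qed.

(** The recurrence [B(p+1,q) = p/(p+q) B(p,q)], obtained by splitting
    [1 = t + (1 - t)] and integrating by parts. *)
Lemma beta_real_rec {R : realType} (c d : R) : 0 <= c -> 0 <= d ->
  (c + d + 2) * beta_real (c + 2) (d + 1) = (c + 1) * beta_real (c + 1) (d + 1).
Proof.
move=> c0 d0.
have c1 : 0 <= c + 1 by rewrite addr_ge0.
have d1 : 0 <= d + 1 by rewrite addr_ge0.
have -> : c + 2 = c + 1 + 1 by ring.
rewrite !beta_realE.
have := beta_parts _ _ c0 d0.
have : \int[lebesgue_measure]_(t in `[0, 1]) beta_weight c d t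
   = \int[lebesgue_measure]_(t in `[0, 1]) beta_weight (c + 1) d t
   + \int[lebesgue_measure]_(t in `[0, 1]) beta_weight c (d + 1) t.
  rewrite -(int01D _ _ (beta_weight_cont _ _ c1 d0) (beta_weight_cont _ _ c0 d1)).
  apply: eq_Rintegral => t; rewrite inE/= in_itv/= => /andP[t0 t1].
  by rewrite -(beta_weight_shift c d t c0 t0) -(beta_weight_shiftr c d t d0 t1) -mulrDl subrKC mul1r.
move: (Rintegral _ _ _) (Rintegral _ _ _) (Rintegral _ _ _) => I I1 I2 -> P.
rewrite mulrDr -P; ring.
Qed.

Lemma beta_mean_cont {R : realType} (c d : R) (g : R -> R) : 0 <= c -> 0 <= d ->
  cont01 g ->
  cont01 (fun t => beta_weight c d t / beta_real (c + 1) (d + 1) * g t).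
Proof.
move=> c0 d0 cg; apply: cont01M => //.
by apply: cont01M; [exact: beta_weight_cont | exact: cont01_cst].
Qed.

Lemma beta_meanD {R : realType} (c d : R) (g h : R -> R) : 0 <= c -> 0 <= d ->
  cont01 g -> cont01 h ->
  beta_mean c d (fun t => g t + h t) = beta_mean c d g + beta_mean c d h.
Proof.
move=> c0 d0 cg ch; rewrite /beta_mean.
rewrite -(int01D _ _ (beta_mean_cont _ _ _ c0 d0 cg) (beta_mean_cont _ _ _ c0 d0 ch)).
by apply: eq_Rintegral => t _; rewrite mulrDr.
Qed.

Lemma beta_meanZ {R : realType} (c d z : R) (g : R -> R) : 0 <= c -> 0 <= d ->
  cont01 g -> beta_mean c d (fun t => z * g t) = z * beta_mean c d g.
Proof.
move=> c0 d0 cg; rewrite /beta_mean -(int01Z _ _ (beta_mean_cont _ _ _ c0 d0 cg)).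
by apply: eq_Rintegral => t _; rewrite mulrCA.
Qed.

Lemma beta_mean_cst {R : realType} (c d z : R) : 0 <= c -> 0 <= d ->
  beta_mean c d (fun _ => z) = z.
Proof.
move=> c0 d0; rewrite /beta_mean.
have B0 := beta_real_gt0 _ _ c0 d0.
transitivity (\int[lebesgue_measure]_(t in `[0, 1])
    ((beta_real (c + 1) (d + 1))^-1 * z * beta_weight c d t)).
  by apply: eq_Rintegral => t _; rewrite -mulrA mulrC.
rewrite (int01Z _ _ (beta_weight_cont _ _ c0 d0)) -beta_realE.
by rewrite mulrAC mulVf ?mul1r// gt_eqF.
Qed.

Lemma le_beta_mean {R : realType} (c d : R) (g h : R -> R) : 0 <= c -> 0 <= d ->
  cont01 g -> cont01 h -> (forall t, 0 <= t <= 1 -> g t <= h t) ->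
  beta_mean c d g <= beta_mean c d h.
Proof.
move=> c0 d0 cg ch gh; apply: le_Rintegral => //.
- exact/cont01_integrable/beta_mean_cont.
- exact/cont01_integrable/beta_mean_cont.
move=> t /=; rewrite in_itv/= => t01; apply: ler_wpM2l; last exact: gh.
by rewrite divr_ge0 ?beta_weight_ge0// ltW// beta_real_gt0.
Qed.

(** Multiplying the density by [t] gives, up to the factor [(c+1)/(c+d+2)], the
    density with [c] replaced by [c + 1]. Polynomials in Horner form are
    therefore integrated one coefficient at a time. *)
Lemma beta_mean_horner {R : realType} (c d z : R) (g : R -> R) : 0 <= c -> 0 <= d ->
  cont01 g ->
  beta_mean c d (fun t => z + t * g t) = z + (c + 1) / (c + d + 2) * beta_mean (c + 1) d g.
Proof.
move=> c0 d0 cg.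
have c1 : 0 <= c + 1 by rewrite addr_ge0.
rewrite beta_meanD//; [|exact: cont01_cst|by apply: cont01M => //; exact: cont01_id].
rewrite beta_mean_cst//; congr (_ + _).
rewrite /beta_mean -(int01Z _ _ (beta_mean_cont _ _ _ c1 d0 cg)).
apply: eq_Rintegral => t; rewrite inE/= in_itv/= => /andP[t0 t1].
have B0 := beta_real_gt0 _ _ c0 d0.
have s0 : 0 < c + d + 2 by rewrite ltr_wpDl// addr_ge0.
have E := beta_real_rec c d c0 d0.
rewrite -(beta_weight_shift c d t c0 t0).
have -> : c + 1 + 1 = c + 2 by ring.
move: E B0; move: (beta_real (c + 1) _) (beta_real (c + 2) _) (beta_weight c d t) (g t).
move=> B B' w gt E B0.
have -> : B' = (c + 1) * B / (c + d + 2).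
  by rewrite -E mulrAC divff ?mul1r// gt_eqF.
have : c + 1 != 0 by rewrite gt_eqF// ltr_wpDl.
move: B0 s0 => /lt0r_neq0 B0 /lt0r_neq0 s0 c0'.
by field; rewrite c0' B0 s0.
Qed.

Lemma beta_mean_poly4 {R : realType} (c d z0 z1 z2 z3 z4 : R) : 0 <= c -> 0 <= d ->
  let s := c + d + 2 in
  beta_mean c d (fun t => z0 + t * (z1 + t * (z2 + t * (z3 + t * z4))))
  = z0 + (c + 1) / s * (z1 + (c + 2) / (s + 1) * (z2
    + (c + 3) / (s + 2) * (z3 + (c + 4) / (s + 3) * z4))).
Proof.
move=> c0 d0 s.
have k0 := cont01_cst z4.
have k1 : cont01 (fun t => z3 + t * z4).
  by apply: cont01D; [exact: cont01_cst|apply: cont01M => //; exact: cont01_id].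
have k2 : cont01 (fun t => z2 + t * (z3 + t * z4)).
  by apply: cont01D; [exact: cont01_cst|apply: cont01M => //; exact: cont01_id].
have k3 : cont01 (fun t => z1 + t * (z2 + t * (z3 + t * z4))).
  by apply: cont01D; [exact: cont01_cst|apply: cont01M => //; exact: cont01_id].
have c1 : 0 <= c + 1 by lra.
have c2 : 0 <= c + 1 + 1 by lra.
have c3 : 0 <= c + 1 + 1 + 1 by lra.
have c4 : 0 <= c + 1 + 1 + 1 + 1 by lra.
rewrite (beta_mean_horner _ _ _ _ c0 d0 k3) (beta_mean_horner _ _ _ _ c1 d0 k2).
rewrite (beta_mean_horner _ _ _ _ c2 d0 k1) (beta_mean_horner _ _ _ _ c3 d0 k0).
rewrite beta_mean_cst// /s.
have -> : c + 1 + 1 = c + 2 by ring.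
have -> : c + 2 + 1 = c + 3 by ring.
have -> : c + 3 + 1 = c + 4 by ring.
have -> : c + 1 + d + 2 = c + d + 2 + 1 by ring.
have -> : c + 2 + d + 2 = c + d + 2 + 2 by ring.
by have -> : c + 3 + d + 2 = c + d + 2 + 3 by ring.
Qed.

Lemma beta_mean_moment1 {R : realType} (c d x : R) : 0 <= c -> 0 <= d ->
  beta_mean c d (fun t => t - x) = (c + 1) / (c + d + 2) - x.
Proof.
move=> c0 d0; transitivity (beta_mean c d (fun t => - x + t * (1 + t * (0 + t * (0 + t * 0))))).
  by congr beta_mean; apply/funext => t; ring.
by rewrite beta_mean_poly4// !(mulr0, addr0) mulr1 addrC.
Qed.

Lemma beta_mean_moment2 {R : realType} (c d x : R) : 0 <= c -> 0 <= d ->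
  beta_mean c d (fun t => (t - x) ^+ 2)
  = x ^+ 2 + (c + 1) / (c + d + 2) * (- 2 * x + (c + 2) / (c + d + 2 + 1)).
Proof.
move=> c0 d0; transitivity
    (beta_mean c d (fun t => x ^+ 2 + t * (- 2 * x + t * (1 + t * (0 + t * 0))))).
  by congr beta_mean; apply/funext => t; ring.
by rewrite beta_mean_poly4// !(mulr0, addr0) mulr1.
Qed.

(** The exact central moment is [3ab(ab(s-6) + 2s^2) / (s^4(s+1)(s+2)(s+3))]
    with [a = c + 1], [b = d + 1], [s = a + b]; the bound uses [ab <= s^2]. *)
Lemma beta_mean_central4_le {R : realType} (c d : R) : 0 <= c -> 0 <= d ->
  beta_mean c d (fun t => (t - (c + 1) / (c + d + 2)) ^+ 4) <= 3 / (c + d + 2) ^+ 2.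
Proof.
move=> c0 d0; set y := (c + 1) / (c + d + 2).
have := beta_mean_poly4 c d (y ^+ 4) (- 4 * y ^+ 3) (6 * y ^+ 2) (- 4 * y) 1 c0 d0.
set s := c + d + 2 in y *.
have s2 : 2 <= s by rewrite /s; lra.
have sn0 : s != 0 by rewrite gt_eqF//; lra.
have sn1 : s + 1 != 0 by rewrite gt_eqF//; lra.
have sn2 : s + 2 != 0 by rewrite gt_eqF//; lra.
have sn3 : s + 3 != 0 by rewrite gt_eqF//; lra.
rewrite (_ : (fun t => _ + t * _) = (fun t => (t - y) ^+ 4)); last first.
  by apply/funext => t; ring.
move=> /= ->.
pose a := c + 1; pose b := d + 1.
have ab : a + b = s by rewrite /a /b /s; ring.
have P0 : 0 <= a * b by rewrite mulr_ge0 /a /b; lra.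
have P1 : a * b <= s ^+ 2.
  rewrite -ab; have := sqr_ge0 a; have := sqr_ge0 b; nra.
rewrite [leLHS](_ : _ = 3 * (a * b) * (a * b * (s - 6) + 2 * s ^+ 2)
   / (s ^+ 4 * (s + 1) * (s + 2) * (s + 3))); last first.
  rewrite /y /a; have -> : b = s - (c + 1) by rewrite -ab /a; ring.
  by field; rewrite sn0 sn1 sn2 sn3.
have D0 : 0 < s ^+ 4 * (s + 1) * (s + 2) * (s + 3).
  by rewrite !mulr_gt0 ?exprn_gt0//; lra.
rewrite ler_pdivrMr// [leRHS](_ : _ = 3 * s ^+ 2 * ((s + 1) * (s + 2) * (s + 3))); last first.
  by field.
rewrite -subr_ge0.
have h1 : a * b * (s - 6) + 2 * s ^+ 2 <= s ^+ 2 * (s + 2) by nra.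
have h2 : 3 * (a * b) * (a * b * (s - 6) + 2 * s ^+ 2) <= 3 * s ^+ 2 * (s ^+ 2 * (s + 2)).
  have [h|h] := leP 0 (a * b * (s - 6) + 2 * s ^+ 2).
    exact: (ler_pM (mulr_ge0 (ler0n _ 3) P0) h (ler_wpM2l (ler0n _ 3) P1) h1).
  apply: (@le_trans _ _ 0).
    by apply: mulr_ge0_le0; [apply: mulr_ge0 | exact: ltW].
  by have := sqr_ge0 s; move=> ?; repeat (apply: mulr_ge0 => //); lra.
rewrite subr_ge0; apply: (le_trans h2); apply: ler_wpM2l.
  by apply: mulr_ge0 => //; exact: sqr_ge0.
nra.
Qed.

(** * Taylor's formula with a uniform remainder *)

Lemma has_derivative_onP {R : realType} (A : set R) (f f' : R -> R) (x e : R) :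
  has_derivative_on A f f' -> A x -> 0 < e ->
  exists2 d, 0 < d & forall y, A y -> y != x -> `|x - y| < d ->
    `|f' x - (f y - f x) / (y - x)| < e.
Proof.
move=> hf Ax e0; have /cvgrPdist_lt/(_ e e0) := hf x Ax.
move=> [d /= d0 hd]; exists d => // y Ay yx xy.
exact: hd.
Qed.

Lemma has_derivative_on_cont01 {R : realType} (f f' : R -> R) :
  has_derivative_on `[0, 1] f f' -> cont01 f.
Proof.
move=> hf; apply/subspace_continuousP => x Ax.
apply/cvgrPdist_lt => e e0.
have [d d0 hd] := has_derivative_onP _ _ _ _ _ hf Ax (@ltr01 R).
have M0 : 0 < `|f' x| + 1 by rewrite ltr_wpDl.
exists (Num.min d (e / (`|f' x| + 1))) => /=; first by rewrite lt_min d0 divr_gt0.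
move=> y /= xy Ay.
have [->|yx] := eqVneq y x; first by rewrite subrr normr0.
move: xy; rewrite lt_min => /andP[xyd xye].
have q1 := hd y Ay yx xyd.
have yx0 : y - x != 0 by rewrite subr_eq0.
set q := (f y - f x) / (y - x) in q1.
have -> : f x - f y = q * (x - y) by rewrite /q -[x - y]opprB mulrN mulfVK// opprB.
have qM : `|q| <= `|f' x| + 1.
  rewrite -[q](subKr (f' x)) (le_trans (ler_normB _ _))//.
  by rewrite lerD2l ltW.
rewrite normrM; apply: (@le_lt_trans _ _ ((`|f' x| + 1) * `|x - y|)).
  by rewrite ler_wpM2r.
by rewrite mulrC -ltr_pdivlMr.
Qed.

(** At interior points the one-sided restriction on difference quotients
    disappears, which gives access to the mean value theorem. *)
Lemma has_derivative_on_is_derive {R : realType} (f f' : R -> R) (x : R) :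
  has_derivative_on `[0, 1] f f' -> 0 < x < 1 -> is_derive x 1 f (f' x).
Proof.
move=> hf /andP[x0 x1].
have Ax : `[0, 1]%classic x by rewrite /= in_itv/= !ltW.
suff C : h^-1 *: (f (h *: 1 + x) - f x) @[h --> 0^'] --> f' x.
  apply: DeriveDef; first by apply/cvg_ex; exists (f' x); exact: C.
  exact: cvg_lim C.
apply/cvgrPdist_lt => e e0.
have [d d0 hd] := has_derivative_onP _ _ _ _ _ hf Ax e0.
exists (Num.min d (Num.min x (1 - x))) => /=; first by rewrite !lt_min d0 x0 subr_gt0.
move=> h /=; rewrite sub0r normrN !lt_min => /and3P[hd1 hx h1x] h0.
rewrite [_ *: 1]mulr1 [_ *: (_ - _)]mulrC -[X in _ / X](addrK x h); apply: hd.
- rewrite /= in_itv/=; move: hx h1x; rewrite !ltr_norml => /andP[] ? ? /andP[] ? ?.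
  by apply/andP; split; lra.
- by rewrite -subr_eq0 addrK.
- by rewrite opprD addrCA subrr addr0 normrN.
Qed.

Lemma cont01_bounded {R : realType} (g : R -> R) : cont01 g ->
  exists M, forall x, 0 <= x <= 1 -> `|g x| <= M.
Proof.
move=> cg.
have /compact_bounded[M [_ hM]] := continuous_compact cg (@segment_compact R 0 1).
exists (M + 1) => x x01; apply: (hM (M + 1)); first by rewrite ltrDl.
by exists x => //=; rewrite in_itv.
Qed.

(** Uniform continuity in a form that is a polynomial in the distance: pairs
    closer than some [d] are handled by [e], and for the others the bound [2 M]
    on the oscillation is at most [2 M / d ^+ 2 * (y - x) ^+ 2]. Means of such a
    bound are moments. *)
Lemma cont01_modulus {R : realType} (g : R -> R) (e : R) : cont01 g -> 0 < e ->
  exists2 K : R, 0 <= K & forall x y : R, 0 <= x <= 1 -> 0 <= y <= 1 ->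
    `|g y - g x| <= e + K * (y - x) ^+ 2.
Proof.
move=> cg e0.
have cK := @segment_compact R 0 1.
have [d d0 hd] : exists2 d : R, 0 < d & forall x y : R, 0 <= x <= 1 -> 0 <= y <= 1 ->
    `|x - y| < d -> `|g y - g x| <= e.
  move/compact_near_coveringP : cK.
  move=> /(_ R (0^'+) (fun d x => 0 <= x <= 1 -> forall y, 0 <= y <= 1 ->
    `|x - y| < d -> `|g y - g x| <= e) _).
  case.
    move=> x /=; rewrite in_itv/= => x01.
    move/subspace_continuousP : cg => /(_ x); rewrite /= in_itv/= => /(_ x01).
    move/cvgrPdist_lt => /(_ (e / 2)); rewrite divr_gt0// => /(_ isT)[d /= d0 hd].
    exists (ball x (d / 2), [set r | r < d / 2]).
      split; first by apply: nbhsx_ballx; rewrite divr_gt0.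
      by apply: nbhs_right_lt; rewrite divr_gt0.
    move=> [x' r] /= [xx' rd] x'01 y y01 x'y.
    have h1 : `|g x - g x'| < e / 2.
      by apply: hd; rewrite /= ?in_itv//= (lt_trans xx')//; lra.
    have h2 : `|g x - g y| < e / 2.
      apply: hd; rewrite /= ?in_itv//=.
      rewrite -(subrKA x') (le_lt_trans (ler_normD _ _))//.
      move: xx'; rewrite /ball/= => xx'; lra.
    rewrite -(subrKA (g x)) (le_trans (ler_normD _ _))// distrC.
    lra.
  move=> d /= d0 hd; exists (d / 2); first by rewrite divr_gt0.
  move=> x y x01 y01 xy; apply: (hd (d / 2)) => //=.
  - by rewrite sub0r normrN gtr0_norm ?divr_gt0//; lra.
  - by rewrite divr_gt0.
have [M hM] := cont01_bounded _ cg.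
have M0 : 0 <= M by apply: (le_trans (normr_ge0 (g 0))); apply: hM; rewrite lexx ler01.
exists (2 * M / d ^+ 2); first by rewrite divr_ge0 ?sqr_ge0 ?mulr_ge0.
move=> x y x01 y01.
have [xy|xy] := ltP `|x - y| d.
  apply: le_trans (hd x y x01 y01 xy) _.
  by rewrite lerDl mulr_ge0 ?sqr_ge0 ?divr_ge0 ?sqr_ge0 ?mulr_ge0.
have : `|g y - g x| <= 2 * M.
  by apply: le_trans (ler_normB _ _) _; have := hM _ x01; have := hM _ y01; lra.
have : 1 <= (y - x) ^+ 2 / d ^+ 2.
  rewrite ler_pdivlMr ?exprn_gt0// mul1r -[leRHS]ger0_norm ?sqr_ge0// normrX.
  by apply: lerXn2r; rewrite ?nnegrE ?normr_ge0 ?(ltW d0)// distrC.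
set q := (y - x) ^+ 2 / _ => q1 gM.
have -> : 2 * M / d ^+ 2 * (y - x) ^+ 2 = 2 * M * q by rewrite /q; ring.
nra.
Qed.

(** The mean value theorem without an order between [x] and [t]; the location
    of [xi] is recorded by its distance to [x]. *)
Lemma MVT01 {R : realType} (h dh : R -> R) (x t : R) : cont01 h ->
  (forall z : R, 0 < z < 1 -> is_derive z 1 h (dh z)) ->
  0 <= x <= 1 -> 0 <= t <= 1 ->
  exists xi, [/\ 0 <= xi <= 1, (xi - x) ^+ 2 <= (t - x) ^+ 2
    & h t - h x = dh xi * (t - x)].
Proof.
move=> ch dhP /andP[x0 x1] /andP[t0 t1].
have seg (a b : R) : 0 <= a -> b <= 1 -> a <= b ->
    exists2 c, c \in `[a, b]%R & h b - h a = dh c * (b - a).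
  move=> a0 b1 ab; apply: MVT_segment => //.
    move=> z; rewrite in_itv/= => /andP[az zb]; apply: dhP.
    by rewrite (le_lt_trans a0 az) (lt_le_trans zb b1).
  apply: continuous_subspaceW ch => z /=; rewrite !in_itv/= => /andP[az zb].
  by rewrite (le_trans a0 az) (le_trans zb b1).
have [xt|tx] := leP x t.
  have [c] := seg x t x0 t1 xt; rewrite in_itv/= => /andP[xc ct] E.
  by exists c; split => //; [apply/andP; split; lra | nra].
have [c] := seg t x t0 x1 (ltW tx); rewrite in_itv/= => /andP[tc cx] E.
exists c; split; [by apply/andP; split; lra | nra | ].
by rewrite -[LHS]opprB E; ring.
Qed.

(** The mean value theorem applied to the remainder gives
    [(f' xi - f' x - f'' x * (xi - x)) * (t - x)], and applied again to the first
    factor gives [(f'' eta - f'' x) * (xi - x) * (t - x)], where [eta] and [xi]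
    are no farther from [x] than [t] is. *)
Lemma taylor2 {R : realType} (f f' f'' : R -> R) (e : R) :
  has_derivative_on `[0, 1] f f' -> has_derivative_on `[0, 1] f' f'' ->
  cont01 f'' -> 0 < e ->
  exists2 K : R, 0 <= K & forall x t : R, 0 <= x <= 1 -> 0 <= t <= 1 ->
    `|f t - (f x + f' x * (t - x) + f'' x / 2 * (t - x) ^+ 2)|
    <= e * (t - x) ^+ 2 + K * (t - x) ^+ 4.
Proof.
move=> hf hf' cf'' e0.
have cf := has_derivative_on_cont01 _ _ hf.
have cf' := has_derivative_on_cont01 _ _ hf'.
have [K K0 hK] := cont01_modulus _ _ cf'' e0.
exists K => // x t x01 t01.
pose h1 s := f' s - f'' x * (s - x).
pose h0 s := f s - (f' x * (s - x) + f'' x / 2 * (s - x) ^+ 2).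
have clin : cont01 (fun s : R => s - x).
  by apply: cont01D; [exact: cont01_id | exact: cont01_cst].
have ch1 : cont01 h1.
  have -> : h1 = (fun s => f' s + - f'' x * (s - x)).
    by apply/funext => s; rewrite /h1 mulNr.
  by apply: cont01D => //; apply: cont01M => //; exact: cont01_cst.
have ch0 : cont01 h0.
  have -> : h0 = (fun s => f s + ((- f' x) * (s - x) + (- (f'' x / 2)) * ((s - x) * (s - x)))).
    by apply/funext => s; rewrite /h0; ring.
  apply: cont01D => //; apply: cont01D; apply: cont01M; rewrite //; try exact: cont01_cst.
  exact: cont01M.
have dh1 (z : R) : 0 < z < 1 -> is_derive z 1 h1 (f'' z - f'' x).
  move=> z01; have := has_derivative_on_is_derive _ _ _ hf' z01 => D.
  rewrite /h1; apply: is_derive_eq.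
  by rewrite subr0 [_ *: 1]mulr1.
have dh0 (z : R) : 0 < z < 1 -> is_derive z 1 h0 (f' z - (f' x + f'' x * (z - x))).
  move=> z01; have := has_derivative_on_is_derive _ _ _ hf z01 => D.
  rewrite /h0; apply: is_derive_eq.
  by rewrite /GRing.scale/=; field.
have [xi [xi01 xit E0]] := MVT01 _ _ _ _ ch0 dh0 x01 t01.
have [eta [eta01 etaxi E1]] := MVT01 _ _ _ _ ch1 dh1 x01 xi01.
have {E0} -> : f t - (f x + f' x * (t - x) + f'' x / 2 * (t - x) ^+ 2)
    = (f'' eta - f'' x) * ((xi - x) * (t - x)).
  transitivity (h0 t - h0 x); first by rewrite /h0; ring.
  rewrite E0 mulrA -E1 /h1; ring.
rewrite normrM.
have := hK _ _ x01 eta01.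
have -> : e * (t - x) ^+ 2 + K * (t - x) ^+ 4 = (e + K * (t - x) ^+ 2) * (t - x) ^+ 2.
  by ring.
move=> h; apply: ler_pM => //.
  by apply: (le_trans h); rewrite lerD2l ler_wpM2l// (le_trans etaxi).
rewrite ler_norml; move: xit; set a := xi - x; set b := t - x => ab.
by apply/andP; split; [have := sqr_ge0 (a + b) | have := sqr_ge0 (a - b)]; nra.
Qed.

(** * The operator as a mixture of Beta means *)

Definition mu_mean {R : realType} (rho : R) (n k : nat) (g : R -> R) : R :=
  beta_mean (k%:R * rho) ((n - k)%:R * rho) g.

Lemma JM1E {R : realType} (alpha rho : R) (a0 a1 : nat -> R) (r : nat)
    (f : R -> R) (x : R) :
  JM1 alpha rho a0 a1 r.+3 f x
  = mod_mean alpha (a1 r.+3 * x + a0 r.+3) (a1 r.+3 * (1 - x) + a0 r.+3) r x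
      (fun k => mu_mean rho r.+3 k f).
Proof.
suff sumE A B (g : nat -> R) : \sum_(k < r.+4)
    (A * alpha_basis alpha r.+2 k x + B * alpha_basis alpha r.+2 (k%:Z - 1) x) * g k
    = mod_mean alpha A B r x g.
  rewrite /JM1 subn1; exact: sumE.
rewrite /mod_mean -sum_alpha_basisS -sum_alpha_basis_pred !big_distrr -big_split.
by apply: eq_bigr => k _; rewrite mulrDl -!mulrA.
Qed.

Lemma mu_mean_params {R : realType} (rho : R) (n k : nat) : 0 < rho -> (k <= n)%N ->
  [/\ 0 <= k%:R * rho, 0 <= (n - k)%:R * rho
    & k%:R * rho + (n - k)%:R * rho = n%:R * rho].
Proof.
move=> r0 kn; split; [by rewrite mulr_ge0// ltW..|].
by rewrite -mulrDl -natrD subnKC.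
Qed.

Lemma mu_mean_moment1 {R : realType} (rho x : R) (n k : nat) :
  0 < rho -> (k <= n)%N ->
  mu_mean rho n k (fun t => t - x)
  = (rho * (k%:R - n%:R * x) + 1 - 2 * x) / (n%:R * rho + 2).
Proof.
move=> r0 kn; have [c0 d0 E] := mu_mean_params _ _ _ r0 kn.
rewrite /mu_mean beta_mean_moment1// E.
have : n%:R * rho + 2 != 0 by rewrite gt_eqF// ltr_wpDl// mulr_ge0// ltW.
move: (n%:R) (k%:R) => N K s0; field; exact: s0.
Qed.

Lemma mu_mean_moment2 {R : realType} (rho x : R) (n k : nat) :
  0 < rho -> (k <= n)%N ->
  mu_mean rho n k (fun t => (t - x) ^+ 2)
  = (n%:R * rho * (x * (1 - x)) + 2 - 6 * (x * (1 - x))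
     + 3 * rho * (1 - 2 * x) * (k%:R - n%:R * x)
     + rho ^+ 2 * (k%:R - n%:R * x) ^+ 2)
    / ((n%:R * rho + 2) * (n%:R * rho + 3)).
Proof.
move=> r0 kn; have [c0 d0 E] := mu_mean_params _ _ _ r0 kn.
rewrite /mu_mean beta_mean_moment2// E.
have s0 : n%:R * rho + 2 != 0 by rewrite gt_eqF// ltr_wpDl// mulr_ge0// ltW.
have s1 : n%:R * rho + 3 != 0 by rewrite gt_eqF// ltr_wpDl// mulr_ge0// ltW.
have -> : n%:R * rho + 2 + 1 = n%:R * rho + 3 by ring.
move: (n%:R) (k%:R) s0 s1 => N K s0 s1; field; by rewrite s0 s1.
Qed.

(** Splitting at the mean [m] of the Beta law, [t - x = (t - m) + (m - x)]
    and [m - x = (rho * (k - n x) + 1 - 2 x) / (n rho + 2)]. *)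
Lemma mu_mean_moment4_le {R : realType} (rho x : R) (n k : nat) :
  0 < rho -> (k <= n)%N -> (0 < n)%N -> 0 <= x <= 1 ->
  mu_mean rho n k (fun t => (t - x) ^+ 4)
  <= 24 / (n%:R * rho) ^+ 2 + 64 / (n%:R * rho) ^+ 4
     + 64 / n%:R ^+ 4 * (k%:R - n%:R * x) ^+ 4.
Proof.
move=> r0 kn n0 x01; have [c0 d0 E] := mu_mean_params _ _ _ r0 kn.
have M1 := mu_mean_moment1 _ x _ _ r0 kn.
rewrite /mu_mean beta_mean_moment1// E in M1.
rewrite /mu_mean.
have := beta_mean_central4_le _ _ c0 d0; rewrite E.
set c := k%:R * rho in c0 E M1 *; set d := (n - k)%:R * rho in d0 E *.
set D := k%:R - n%:R * x in M1 *.
have N0 : 0 < n%:R * rho by rewrite mulr_gt0 ?ltr0n.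
set m := (c + 1) / (n%:R * rho + 2) in M1 * => C4.
pose e := m - x.
have e4 : e ^+ 4 <= 8 * (rho ^+ 4 * D ^+ 4 + 1) / (n%:R * rho) ^+ 4.
  rewrite /e M1 expr_div_n -addrA; set b := 1 - 2 * x.
  have b4 : b ^+ 4 <= 1.
    have b2 : b ^+ 2 <= 1 by move/andP: x01 => [x0 x1]; rewrite /b; nra.
    have := sqr_ge0 b; nra.
  have p1 : (rho * D + b) ^+ 4 <= 8 * (rho ^+ 4 * D ^+ 4 + 1).
    by apply: le_trans (expr4D_le _ _) _; rewrite exprMn; lra.
  have p0 : 0 <= (rho * D + b) ^+ 4 by rewrite exprn_even_ge0.
  apply: ler_pM => //; first by rewrite invr_ge0 exprn_ge0//; lra.
  rewrite lef_pV2 ?posrE ?exprn_gt0//; last lra.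
  by apply: lerXn2r; rewrite ?nnegrE; lra.
apply: (@le_trans _ _ (beta_mean c d (fun t => 8 * (t - m) ^+ 4 + 8 * e ^+ 4))).
  apply: le_beta_mean => //; first exact: cont01_pow.
    apply: cont01D; last exact: cont01_cst.
    by apply: cont01M; [exact: cont01_cst | exact: cont01_pow].
  move=> t _; have := expr4D_le (t - m) e.
  have -> : t - m + e = t - x by rewrite /e; ring.
  lra.
rewrite beta_meanD//; last exact: cont01_cst; last first.
  by apply: cont01M; [exact: cont01_cst | exact: cont01_pow].
rewrite beta_meanZ//; last exact: cont01_pow.
rewrite beta_mean_cst//.
have h1 : 3 / (n%:R * rho + 2) ^+ 2 <= 3 / (n%:R * rho) ^+ 2.
  rewrite ler_wpM2l// lef_pV2 ?posrE ?exprn_gt0//; last lra.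
  by apply: lerXn2r; rewrite ?nnegrE; lra.
have -> : 64 / n%:R ^+ 4 * D ^+ 4 = 64 * rho ^+ 4 * D ^+ 4 / (n%:R * rho) ^+ 4.
  have n1 : n%:R != 0 :> R by rewrite pnatr_eq0 -lt0n.
  move: n1 r0; move: (n%:R) => N N1 /lt0r_neq0 r1.
  by field; rewrite N1 r1.
move: h1 C4 e4; set q := ((n%:R * rho) ^+ 4)^-1; set p := ((n%:R * rho) ^+ 2)^-1.
move=> h1 C4 e4.
have : 8 * beta_mean c d (fun t : R => (t - m) ^+ 4) <= 24 * p by lra.
have : 8 * e ^+ 4 <= 64 * q + 64 * rho ^+ 4 * D ^+ 4 * q by lra.
lra.
Qed.

(** * Exact moments and remainder *)

(** With [a] standing for [a0 n], [n] times the first moment is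
    [(1 - 2 * x) * moment1_coef rho a n], and [n] times the second moment is
    [x * (1 - x) * moment2_coef alpha rho a n + moment2_err rho a n]. The
    ratios are kept apart because each of them converges by itself. *)
Definition moment1_coef {R : realType} (rho a : R) (n : nat) : R :=
  n%:R / (n%:R * rho + 2) * (rho * (1 - a) + 1).

Definition moment2_coef {R : realType} (alpha rho a : R) (n : nat) : R :=
  n%:R / (n%:R * rho + 2) * (n%:R / (n%:R * rho + 3)) * (rho + rho ^+ 2)
  + n%:R / (n%:R * rho + 2) * (n%:R * rho + 3)^-1
    * (- 6 - 12 * rho * (1 - a) + rho ^+ 2 * (4 * a - 2 - 2 * alpha)).

Definition moment2_err {R : realType} (rho a : R) (n : nat) : R :=
  n%:R / (n%:R * rho + 2) * (n%:R * rho + 3)^-1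
  * (2 + (3 * rho + rho ^+ 2) * (1 - a)).

(** The sums are those of polynomials of degree 2 in [k - n x], so they are known
    exactly; separating [x] from [n] uses [(1 - 2 * x) ^+ 2 = 1 - 4 * (x * (1 - x))]
    and the special form of [A] and [B]. *)
Lemma scaled_moments {R : realType} (alpha rho x a y0 y1 y2 : R) (r : nat) :
  0 < rho ->
  let n := r.+3 in
  let A := x + a * (1 - 2 * x) in let B := 1 - x - a * (1 - 2 * x) in
  n%:R * (mod_mean alpha A B r x (fun k => y0 + y1 * mu_mean rho n k (fun t => t - x)
     + y2 * mu_mean rho n k (fun t => (t - x) ^+ 2)) - y0)
  = (1 - 2 * x) * moment1_coef rho a n * y1
    + (x * (1 - x) * moment2_coef alpha rho a n + moment2_err rho a n) * y2.
Proof.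
move=> r0 n A B.
have s0 : n%:R * rho + 2 != 0 by rewrite gt_eqF// ltr_wpDl// mulr_ge0// ltW.
have s1 : n%:R * rho + 3 != 0 by rewrite gt_eqF// ltr_wpDl// mulr_ge0// ltW.
pose i0 := (n%:R * rho + 2)^-1; pose i1 := i0 * (n%:R * rho + 3)^-1.
pose c0 := y0 + y1 * ((1 - 2 * x) * i0)
  + y2 * ((n%:R * rho * (x * (1 - x)) + 2 - 6 * (x * (1 - x))) * i1).
pose c1 := y1 * (rho * i0) + y2 * (3 * rho * (1 - 2 * x) * i1).
pose c2 := y2 * (rho ^+ 2 * i1).
rewrite (@eq_mod_mean _ _ _ _ _ _ _ (fun k => let d := k%:R - r.+3%:R * x in
    c0 + c1 * d + c2 * d ^+ 2)); last first.
  move=> k kn; rewrite (mu_mean_moment1 _ _ _ _ r0 kn) (mu_mean_moment2 _ _ _ _ r0 kn).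
  rewrite invfM -/n -/i0 -/i1 /c0 /c1 /c2 /=.
  by clear c0 c1 c2; clearbody i1 i0; ring.
have AB : A + B = 1 by rewrite /A /B; ring.
rewrite (mod_mean_deg2 _ _ _ _ _ _ _ _ AB).
have -> : r.+2%:R = n%:R - 1 :> R by rewrite /n -[r.+3]addn1 natrD addrK.
rewrite /moment1_coef /moment2_coef /moment2_err -/i0.
rewrite /c0 /c1 /c2 /A /B /i1.
clear c0 c1 c2 i1 AB; clearbody i0; clear A B s0.
by field.
Qed.

(** [moment4_bound rho / n ^+ 2] bounds the fourth moment: the first two terms
    come from [mu_mean_moment4_le], the last one from the binomial bound
    [652 * n ^+ 2] with factor [64]. *)
Definition moment4_bound {R : realType} (rho : R) : R :=
  24 / rho ^+ 2 + 64 / rho ^+ 4 + 64 * 652.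

Lemma moment4_bound_ge0 {R : realType} (rho : R) : 0 < rho -> 0 <= moment4_bound rho.
Proof.
move=> r0; have h (m p : nat) : 0 <= m%:R / rho ^+ p.
  by rewrite divr_ge0 ?exprn_ge0// ltW.
exact: (addr_ge0 (addr_ge0 (h 24%N 2%N) (h 64%N 4%N))
  (mulr_ge0 (ler0n R 64) (ler0n R 652))).
Qed.

(** The quadratic term is absorbed by
    [(t-x)^2 <= 1/(2n) + (n/2) (t-x)^4], so that [E = e n / 2 + K] becomes the
    coefficient of a fourth moment of order [1/n^2]. *)
Lemma mod_mean_remainder_le {R : realType} (alpha rho A B x e K : R) (r : nat)
    (g : R -> R) :
  0 <= alpha <= 1 -> 0 < rho -> 0 <= x <= 1 -> 0 <= e -> 0 <= K -> cont01 g ->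
  (forall t : R, 0 <= t <= 1 -> `|g t| <= e * (t - x) ^+ 2 + K * (t - x) ^+ 4) ->
  r.+3%:R * `|mod_mean alpha A B r x (fun k => mu_mean rho r.+3 k g)|
  <= (`|A| + `|B|)
     * (e * (1 + moment4_bound rho) / 2 + K * moment4_bound rho / r.+3%:R).
Proof.
move=> al r0 x01 e0 K0 cg hg; set n := r.+3; set C := moment4_bound rho.
have n0 : 0 < n%:R :> R by rewrite ltr0n.
have n1 : 1 <= n%:R :> R by rewrite ler1n.
pose E := e * n%:R / 2 + K.
have E0 : 0 <= E by rewrite addr_ge0 ?divr_ge0 ?mulr_ge0.
have ker k : (k <= n)%N -> `|mu_mean rho n k g| <=
    e / (2 * n%:R) + E * (24 / (n%:R * rho) ^+ 2 + 64 / (n%:R * rho) ^+ 4)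
    + E * (64 / n%:R ^+ 4) * (k%:R - n%:R * x) ^+ 4.
  move=> kn; have [c0 d0 _] := mu_mean_params _ _ _ r0 kn.
  pose G t := e / (2 * n%:R) + E * (t - x) ^+ 4.
  have cG : cont01 G.
    apply: cont01D; first exact: cont01_cst.
    by apply: cont01M; [exact: cont01_cst | exact: cont01_pow].
  have gG t : 0 <= t <= 1 -> `|g t| <= G t.
    move=> t01; apply: le_trans (hg t t01) _.
    rewrite /G /E; set w := (t - x) ^+ 2.
    have -> : (t - x) ^+ 4 = w ^+ 2 by rewrite /w -exprM.
    rewrite -subr_ge0.
    have -> : e / (2 * n%:R) + (e * n%:R / 2 + K) * w ^+ 2 - (e * w + K * w ^+ 2)
        = e / (2 * n%:R) * (1 - n%:R * w) ^+ 2.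
      by move: n0 => /lt0r_neq0; move: (n%:R) w => N w N0; field.
    by rewrite mulr_ge0 ?sqr_ge0 ?divr_ge0// ltW// mulr_gt0.
  have KG : mu_mean rho n k G <=
    e / (2 * n%:R) + E * (24 / (n%:R * rho) ^+ 2 + 64 / (n%:R * rho) ^+ 4)
    + E * (64 / n%:R ^+ 4) * (k%:R - n%:R * x) ^+ 4.
    rewrite /mu_mean beta_meanD//; last 2 first.
    - exact: cont01_cst.
    - by apply: cont01M; [exact: cont01_cst | exact: cont01_pow].
    rewrite beta_mean_cst// beta_meanZ//; last exact: cont01_pow.
    rewrite -addrA lerD2l -mulrA -mulrDr; apply: ler_wpM2l => //.
    exact: mu_mean_moment4_le.
  apply: le_trans KG; rewrite ler_norml -mulN1r /mu_mean -beta_meanZ//.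
  by apply/andP; split; apply: le_beta_mean => //;
    first (by apply: cont01M => //; exact: cont01_cst);
    move=> t t01; have := gG t t01; rewrite ?mulN1r ler_norml => /andP[].
apply: (@le_trans _ _ (n%:R * ((`|A| + `|B|) *
   (e / (2 * n%:R) + E * (24 / (n%:R * rho) ^+ 2 + 64 / (n%:R * rho) ^+ 4)
    + E * (64 / n%:R ^+ 4) * (652 * n%:R ^+ 2))))).
  apply: ler_wpM2l; first exact: ltW.
  apply: (le_trans (le_normr_mod_mean _ _ _ _ _ _ _ al x01 ker)).
  apply: mod_mean_pow4_le => //.
  by rewrite mulr_ge0// divr_ge0// exprn_ge0// ltW.
rewrite mulrCA; apply: ler_wpM2l; first by rewrite addr_ge0.
have -> : 64 / n%:R ^+ 4 = 64 * (n%:R ^+ 2)^-1 * (n%:R ^+ 2)^-1 :> R.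
  by move: n0 => /lt0r_neq0; move: (n%:R : R) => N N0; field.
have -> : e * (1 + C) / 2 + K * C / n%:R = n%:R * (e / (2 * n%:R) + E * (C / n%:R ^+ 2)).
  by rewrite /E; clearbody C; move: n0 => /lt0r_neq0; move: (n%:R : R) => N N0; field.
apply: ler_wpM2l; first exact: ltW.
rewrite -addrA lerD2l -!mulrA -mulrDr; apply: ler_wpM2l => //.
have -> : C / n%:R ^+ 2 = 24 / (n%:R * rho) ^+ 2 + 64 / rho ^+ 4 / n%:R ^+ 2
    + 64 * 652 / n%:R ^+ 2.
  rewrite /C /moment4_bound; move: n0 r0 => /lt0r_neq0 + /lt0r_neq0.
  by move: (n%:R : R) => N N0 r0; field; rewrite N0 r0.
apply: lerD.
  rewrite lerD2l exprMn invfM mulrA [leRHS]mulrAC; apply: ler_wpM2r.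
    by rewrite invr_ge0 exprn_ge0// ltW.
  apply: ler_wpM2l => //; rewrite lef_pV2 ?posrE ?exprn_gt0//.
  exact: ler_weXn2l.
rewrite le_eqVlt; apply/orP; left; apply/eqP.
by move: n0 => /lt0r_neq0; move: (n%:R : R) => N N0; field.
Qed.

(** The deviation at a fixed [n] from the value that the Taylor polynomial alone
    would give. *)
Lemma JM1_estimate {R : realType} (alpha rho e K : R) (a0 a1 : nat -> R)
    (f f' f'' : R -> R) (r : nat) (x : R) :
  0 <= alpha <= 1 -> 0 < rho -> 0 <= x <= 1 -> 0 <= e -> 0 <= K -> cont01 f ->
  a1 r.+3 = 1 - 2 * a0 r.+3 ->
  (forall t : R, 0 <= t <= 1 ->
    `|f t - (f x + f' x * (t - x) + f'' x / 2 * (t - x) ^+ 2)|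
    <= e * (t - x) ^+ 2 + K * (t - x) ^+ 4) ->
  `|r.+3%:R * (JM1 alpha rho a0 a1 r.+3 f x - f x)
    - ((1 - 2 * x) * moment1_coef rho (a0 r.+3) r.+3 * f' x
       + (x * (1 - x) * moment2_coef alpha rho (a0 r.+3) r.+3 + moment2_err rho (a0 r.+3) r.+3)
         * (f'' x / 2))|
  <= (2 + 2 * `|a0 r.+3|)
     * (e * (1 + moment4_bound rho) / 2 + K * moment4_bound rho / r.+3%:R).
Proof.
move=> al r0 x01 e0 K0 cf a1E hR; rewrite JM1E a1E; set a := a0 r.+3.
have -> : (1 - 2 * a) * x + a = x + a * (1 - 2 * x) by ring.
have -> : (1 - 2 * a) * (1 - x) + a = 1 - x - a * (1 - 2 * x) by ring.
set A := x + _; set B := 1 - x - _.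
pose g t := f t - (f x + f' x * (t - x) + f'' x / 2 * (t - x) ^+ 2).
have cl : cont01 (fun t => f' x * (t - x)).
  by apply: cont01M; [exact: cont01_cst | exact: (cont01_pow x 1)].
have cq : cont01 (fun t => f'' x / 2 * (t - x) ^+ 2).
  by apply: cont01M; [exact: cont01_cst | exact: cont01_pow].
have cS : cont01 (fun t => f x + f' x * (t - x) + f'' x / 2 * (t - x) ^+ 2).
  by apply: cont01D => //; apply: cont01D => //; exact: cont01_cst.
have cg : cont01 g.
  have -> : g = (fun t => f t + (-1) * (f x + f' x * (t - x) + f'' x / 2 * (t - x) ^+ 2)).
    by apply/funext => t; rewrite /g mulN1r.
  by apply: cont01D => //; apply: cont01M => //; exact: cont01_cst.
have fE k : (k <= r.+3)%N -> mu_mean rho r.+3 k f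
    = (f x + f' x * mu_mean rho r.+3 k (fun t => t - x)
       + f'' x / 2 * mu_mean rho r.+3 k (fun t => (t - x) ^+ 2))
      + mu_mean rho r.+3 k g.
  move=> kr; have [c0 d0 _] := mu_mean_params _ _ _ r0 kr.
  rewrite /mu_mean -(beta_meanZ _ _ (f' x) _ c0 d0 (cont01_pow x 1)).
  rewrite -(beta_meanZ _ _ (f'' x / 2) _ c0 d0 (cont01_pow x 2)).
  rewrite -{1}(beta_mean_cst _ _ (f x) c0 d0) -beta_meanD//; last exact: cont01_cst.
  rewrite -beta_meanD//; last by apply: cont01D => //; exact: cont01_cst.
  rewrite -beta_meanD//; congr beta_mean; apply/funext => t; rewrite /g; ring.
rewrite (@eq_mod_mean _ _ _ _ _ _ _ _ fE) mod_meanD.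
have main := scaled_moments alpha rho x a (f x) (f' x) (f'' x / 2) r r0.
rewrite /= -/A -/B in main.
rewrite addrAC mulrDr main addrAC subrr add0r.
rewrite normrM [`|r.+3%:R|]ger0_norm//.
apply: (le_trans (mod_mean_remainder_le _ _ _ _ _ _ _ _ _ al r0 x01 e0 K0 cg hR)).
have C0 := moment4_bound_ge0 _ r0.
have /andP[x0 x1] := x01.
have b1 : `|a * (1 - 2 * x)| <= `|a|.
  by rewrite normrM ler_piMr// ler_norml; apply/andP; split; lra.
apply: ler_wpM2r.
  apply: addr_ge0; first by rewrite divr_ge0// mulr_ge0// addr_ge0.
  by rewrite divr_ge0// mulr_ge0.
have hA : `|A| <= 1 + `|a|.
  by rewrite /A (le_trans (ler_normD _ _))// lerD// ger0_norm.
have hB : `|B| <= 1 + `|a|.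
  rewrite /B (le_trans (ler_normB _ _))// lerD// ger0_norm ?subr_ge0//.
  by rewrite gerBl.
lra.
Qed.

(** * Passage to the limit *)

Lemma uniform_cvg_dist {R : realType} (A : set R) (F : nat -> R -> R) (g : R -> R) :
  (forall e : R, 0 < e -> \forall n \near \oo, forall x, A x -> `|g x - F n x| < e) ->
  {uniform A, F @ \oo --> g}.
Proof.
move=> H P /uniform_nbhs[E [entE subP]].
move: entE; rewrite -entourage_ballE => -[e /= e0 he].
move: (H e e0); apply: filterS => n Hn.
by apply: subP => y Ay; apply: he; apply: Hn.
Qed.

Lemma cvg_inv_affine {R : realType} (rho c : R) : 0 < rho -> 0 <= c ->
  (fun n : nat => (n%:R * rho + c)^-1) @ \oo --> (0 : R).
Proof.
move=> r0 c0; apply/cvgrPdist_lt => e e0.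
have : \forall n \near \oo, (rho * e)^-1 < n%:R :> R by exact: nbhs_infty_gtr.
apply: filterS => n hn.
have n0 : 0 < n%:R :> R by apply: lt_trans hn; rewrite invr_gt0 mulr_gt0.
have s0 : 0 < n%:R * rho + c by rewrite ltr_wpDr// mulr_gt0.
rewrite sub0r normrN gtr0_norm ?invr_gt0// -(invrK e) ltf_pV2 ?posrE ?invr_gt0//.
by rewrite ltr_wpDr// -ltr_pdivrMr// mulrC -invfM.
Qed.

Lemma cvg_ratio_affine {R : realType} (rho c : R) : 0 < rho -> 0 < c ->
  (fun n : nat => n%:R / (n%:R * rho + c)) @ \oo --> rho^-1.
Proof.
move=> r0 c0.
have -> : (fun n : nat => n%:R / (n%:R * rho + c))
   = (fun n : nat => rho^-1 - c / rho * (n%:R * rho + c)^-1).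
  apply/funext => n; have : n%:R * rho + c != 0.
    by rewrite gt_eqF// ltr_wpDl// mulr_ge0// ltW.
  move: r0 => /lt0r_neq0; move: (n%:R) => N h1 h2; by field; rewrite h1 h2.
rewrite -[X in _ --> X]subr0; apply: cvgB; first exact: cvg_cst.
rewrite -[X in _ --> X](mulr0 (c / rho)); apply: cvgM; first exact: cvg_cst.
by apply: cvg_inv_affine => //; exact: ltW.
Qed.

Lemma main_term_le {R : realType} (x y1 y2 du dp dq M d : R) :
  0 <= x <= 1 -> `|y1| <= M -> `|y2| <= M -> `|du| < d -> `|dp| < d -> `|dq| < d ->
  `|(1 - 2 * x) * du * y1 + (x * (1 - x) * dp + dq) * (y2 / 2)| <= 2 * (M * d).
Proof.
move=> /andP[x0 x1] h1 h2 hu hp hq.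
have prod_le (c w y : R) : `|c| <= 1 -> `|w| < d -> `|y| <= M ->
    `|c * w * y| <= M * d.
  move=> hc hw hy; rewrite mulrAC !normrM; apply: ler_pM; rewrite ?mulr_ge0 ?(ltW hw)//.
  by rewrite -[leRHS]mul1r; apply: ler_pM.
have c1 : `|1 - 2 * x| <= 1 by rewrite ler_norml; apply/andP; split; lra.
have c2 : `|x * (1 - x)| <= 1 by rewrite ler_norml; apply/andP; split; nra.
have b1 := prod_le _ _ _ c1 hu h1.
have b2 := prod_le _ _ _ c2 hp h2.
have b3 : `|1 * dq * y2| <= M * d by apply: prod_le; rewrite ?normr1.
have -> : (x * (1 - x) * dp + dq) * (y2 / 2)
    = (x * (1 - x) * dp * y2 + 1 * dq * y2) / 2 by ring.
have e1 := ler_normD ((1 - 2 * x) * du * y1)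
  ((x * (1 - x) * dp * y2 + 1 * dq * y2) / 2).
have e2 := ler_normD (x * (1 - x) * dp * y2) (1 * dq * y2).
have half (y : R) : `|y / 2| = `|y| / 2.
  by rewrite normrM (@ger0_norm _ (2^-1 : R)) ?invr_ge0.
rewrite half in e1.
clear -b1 b2 b3 e1 e2; lra.
Qed.

Theorem theorem4 (R : realType) (alpha rho : R) (a0 a1 : nat -> R)
    (l0 l1 : R) (f f' f'' : R -> R)
    (halpha : 0 <= alpha <= 1)
    (hrho : 0 < rho)
    (ha0 : a0 @ \oo --> l0)
    (ha1 : a1 @ \oo --> l1)
    (ha : forall n : nat, (2 <= n)%N ->
       2 * a0 n + a1 n = 1 /\ (a0 n < 0 \/ a0 n + a1 n < 0))
    (hf' : has_derivative_on `[0, 1] f f')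
    (hf'' : has_derivative_on `[0, 1] f' f'')
    (hcont : {within `[0, 1], continuous f''}) :
  {uniform `[0, 1],
    (fun (n : nat) (x : R) => n%:R * (JM1 alpha rho a0 a1 n f x - f x))
      @ \oo -->
    (fun x : R =>
       (1 - 2 * x) * ((rho + 2) * l0 + (rho + 1) * l1) / rho * f' x
       + x * (1 - x) * (1 + rho) * (2 * l0 + l1) / (2 * rho) * f'' x)}.
Proof.
have cf := has_derivative_on_cont01 _ _ hf'.
have cf' := has_derivative_on_cont01 _ _ hf''.
have l1E : l1 = 1 - 2 * l0.
  have lim1 : (fun n => 2 * a0 n + a1 n) @ \oo --> (1 : R).
    apply: cvg_near_cst; exists 2%N => // n /= n2; exact: (ha n n2).1.
  have lim2 : (fun n => 2 * a0 n + a1 n) @ \oo --> 2 * l0 + l1.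
    by apply: cvgD => //; apply: cvgM => //; exact: cvg_cst.
  have E : 1 = 2 * l0 + l1 :> R.
    by apply: (cvg_unique _ lim1 lim2) => //; exact: norm_hausdorff.
  by apply: (addrI (2 * l0)); rewrite -E addrCA subrr addr0.
have cvgU : (fun n => moment1_coef rho (a0 n) n) @ \oo --> rho^-1 * (rho * (1 - l0) + 1).
  apply: cvgM; first exact: cvg_ratio_affine.
  apply: cvgD; last exact: cvg_cst.
  apply: cvgM; first exact: cvg_cst.
  by apply: cvgB => //; exact: cvg_cst.
have inv2 : (fun n : nat => n%:R / (n%:R * rho + 2) * (n%:R * rho + 3)^-1)
    @ \oo --> (0 : R).
  rewrite -[X in _ --> X](mulr0 rho^-1); apply: cvgM.
    exact: cvg_ratio_affine.
  exact: cvg_inv_affine.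
have cvgP : (fun n => moment2_coef alpha rho (a0 n) n) @ \oo --> (1 + rho) / rho.
  have -> : (1 + rho) / rho = rho^-1 * rho^-1 * (rho + rho ^+ 2)
     + 0 * (- 6 - 12 * rho * (1 - l0) + rho ^+ 2 * (4 * l0 - 2 - 2 * alpha)).
    by move: hrho => /lt0r_neq0 r0; field.
  apply: cvgD; apply: cvgM => //.
  - by apply: cvgM; exact: cvg_ratio_affine.
  - exact: cvg_cst.
  - apply: cvgD.
      apply: cvgB; first exact: cvg_cst.
      by apply: cvgM; [exact: cvg_cst | apply: cvgB => //; exact: cvg_cst].
    apply: cvgM; first exact: cvg_cst.
    apply: cvgB; last exact: cvg_cst.
    apply: cvgB; last exact: cvg_cst.
    by apply: cvgM => //; exact: cvg_cst.
have cvgQ : (fun n => moment2_err rho (a0 n) n) @ \oo --> (0 : R).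
  rewrite -[X in _ --> X](mul0r (2 + (3 * rho + rho ^+ 2) * (1 - l0))).
  apply: cvgM => //; apply: cvgD; first exact: cvg_cst.
  by apply: cvgM; [exact: cvg_cst | apply: cvgB => //; exact: cvg_cst].
apply: uniform_cvg_dist => eta eta0.
have [M1 hM1] := cont01_bounded _ cf'.
have [M2 hM2] := cont01_bounded _ hcont.
pose M := Num.max M1 M2.
have M0 : 0 <= M.
  apply: (le_trans (normr_ge0 (f' 0))); rewrite le_max hM1//.
  by rewrite lexx ler01.
pose C := moment4_bound rho.
have C0 : 0 <= C := moment4_bound_ge0 _ hrho.
(* [W] bounds [2 + 2 * `|a0 n|] once [`|l0 - a0 n| < 1]; [e] makes the
   non-vanishing part of the remainder equal to [eta / 4]. *)
pose W := 4 + 2 * `|l0|.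
have W0 : 0 < W by rewrite /W ltr_wpDr ?mulr_ge0.
pose e := eta / (2 * W * (1 + C)).
have e0 : 0 < e by rewrite divr_gt0 ?mulr_gt0// ltr_wpDr.
have [K K0 hK] := taylor2 _ _ _ _ hf' hf'' hcont e0.
pose d := eta / (4 * (M + 1)).
have d0 : 0 < d by rewrite divr_gt0 ?mulr_gt0// ltr_wpDl.
have dM : M * d <= eta / 4.
  have : (M + 1) * d = eta / 4.
    by rewrite /d; have : M + 1 != 0; [rewrite gt_eqF// ltr_wpDl | move=> ?; field].
  lra.
near=> n.
have n3 : (3 <= n)%N by near: n; exists 3%N.
have hU : `|rho^-1 * (rho * (1 - l0) + 1) - moment1_coef rho (a0 n) n| < d.
  by near: n; move/cvgrPdist_lt : cvgU => /(_ d d0).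
have hP : `|(1 + rho) / rho - moment2_coef alpha rho (a0 n) n| < d.
  by near: n; move/cvgrPdist_lt : cvgP => /(_ d d0).
have hQ : `|0 - moment2_err rho (a0 n) n| < d.
  by near: n; move/cvgrPdist_lt : cvgQ => /(_ d d0).
have h0 : `|l0 - a0 n| < 1.
  by near: n; move/cvgrPdist_lt : ha0 => /(_ 1 ltr01).
have hn : 4 * W * K * C / eta < n%:R by near: n; exact: nbhs_infty_gtr.
move=> x; rewrite /= in_itv/= => x01.
have a1E : a1 n = 1 - 2 * a0 n
  by apply: (addrI (2 * a0 n)); rewrite (ha n (ltnW n3)).1 addrCA subrr addr0.
have nE : n = (n - 3).+3 by rewrite -addn3 subnK.
have := JM1_estimate alpha rho e K a0 a1 f f' f'' (n - 3) x
  halpha hrho x01 (ltW e0) K0 cf.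
rewrite -nE => /(_ a1E (fun t t01 => hK x t x01 t01)).
rewrite -/C; set J := n%:R * _; set u := moment1_coef _ _ _ in hU *.
set p := moment2_coef _ _ _ _ in hP *; set q := moment2_err _ _ _ in hQ * => est.
have W1 : 2 + 2 * `|a0 n| <= W.
  have : `|a0 n| <= `|l0| + 1.
    by rewrite -(subKr l0 (a0 n)) (le_trans (ler_normB _ _))// lerD2l ltW.
  by rewrite /W; lra.
have n0 : 0 < n%:R :> R by rewrite ltr0n (leq_trans _ n3).
have small : (2 + 2 * `|a0 n|) * (e * (1 + C) / 2 + K * C / n%:R) < eta / 2.
  apply: (@le_lt_trans _ _ (W * (e * (1 + C) / 2 + K * C / n%:R))).
    apply: ler_wpM2r => //; apply: addr_ge0; last by rewrite divr_ge0 ?mulr_ge0// ltW.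
    by rewrite divr_ge0// mulr_ge0 ?(ltW e0)// addr_ge0.
  have -> : W * (e * (1 + C) / 2 + K * C / n%:R) = eta / 4 + W * K * C / n%:R.
    have gen (N c w : R) : N != 0 -> w != 0 -> 1 + c != 0 ->
        w * (eta / (2 * w * (1 + c)) * (1 + c) / 2 + K * c / N)
        = eta / 4 + w * K * c / N.
      by clear; move=> N0 w0 c0; field; rewrite N0 w0 c0.
    by apply: gen; rewrite gt_eqF// ltr_wpDr.
  have : W * K * C / n%:R < eta / 4.
    rewrite ltr_pdivrMr//; move: hn; rewrite ltr_pdivrMr//.
    by move: (n%:R : R) => N; clear; lra.
  by move=> small_tail; clear -small_tail; lra.
have {}est := le_lt_trans est small.
have f1 : `|f' x| <= M by rewrite le_max hM1.
have f2 : `|f'' x| <= M by rewrite le_max hM2 ?orbT.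
set T := (X in `|X - J|).
set G := (X in `|J - X|) in est.
have TG : T - G = (1 - 2 * x) * (rho^-1 * (rho * (1 - l0) + 1) - u) * f' x
    + (x * (1 - x) * ((1 + rho) / rho - p) + (0 - q)) * (f'' x / 2).
  rewrite /T /G l1E; move: hrho => /lt0r_neq0 r0.
  by field.
have TG_le : `|T - G| <= eta / 2.
  rewrite TG; apply: le_trans (main_term_le _ _ _ _ _ _ _ _ x01 f1 f2 hU hP hQ) _.
  by clear -dM; lra.
rewrite -(subrKA G) (le_lt_trans (ler_normD _ _))// [`|G - J|]distrC.
by clear -est TG_le; lra.
Unshelve. all: by end_near.
Qed.
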